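(* Let $K$ be an infinite field, fix natural numbers $d_1,\ldots,d_k$, and consider the polynomial functor $P:V\mapsto S^{d_1}V\oplus\cdots\oplus S^{d_k}V$ on the category $\mathbf{Vec}$ of finite-dimensional $K$-vector spaces, where $S^{e}V$ denotes the $e$-th symmetric power of $V$. Then $P$ is a Noetherian $\mathbf{Vec}$-topological space, and hence its limit $P_\infty:=\varprojlim_n P(K^n)$ is $\mathrm{GL}_\infty$-Noetherian.
   Context: Each $P(V)$ carries the Zariski topology. A closed $\mathbf{Vec}$-subspace $X$ of $P$ is a rule assigning to each $V\in\mathbf{Vec}$ a Zariski-closed subset $X(V)\subseteq P(V)$ such that $P(\varphi)(X(V))\subseteq X(W)$ for every linear map $\varphi:V\to W$. $P$ is a Noetherian $\mathbf{Vec}$-topological space if every descending chain of closed $\mathbf{Vec}$-subspaces of $P$ stabilises (as $\mathbf{Vec}$-subspaces, i.e. from some index on, simultaneously for all $V$). The projective limit $P_\infty$ is taken along the linear maps $P(\pi_n):P(K^{n+1})\to P(K^n)$, where $\pi_n:K^{n+1}\to K^n$ forgets the last coordinate, and has the inverse-limit topology of the Zariski topologies. The group $\mathrm{GL}_n=\mathrm{GL}_n(K)$ acts on $P(K^n)$ by functoriality and is embedded in $\mathrm{GL}_{n+1}$ via $g\mapsto\operatorname{diag}(g,1)$, so that $\mathrm{GL}_\infty:=\bigcup_n\mathrm{GL}_n$ acts on $P_\infty$. $P_\infty$ is $\mathrm{GL}_\infty$-Noetherian if every chain $P_\infty\supseteq Y_1\supseteq Y_2\supseteq\cdots$ of $\mathrm{GL}_\infty$-stable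 closed subsets is eventually constant. *)

(* Defs.v *)
From HB Require Import structures.
From mathcomp Require Import all_boot all_order all_fingroup all_algebra.
From mathcomp Require mpoly boolp.

Set Implicit Arguments.
Unset Strict Implicit.
Unset Printing Implicit Defensive.

Import GRing.Theory.
Local Open Scope ring_scope.

(* The notations of [mpoly] clash with those of the topology library: they are
   only imported inside this module. *)
Module SymmetricPower.
Import mpoly.

Section Sym.
Variable K : fieldType.
Implicit Types (V W U : vectType K) (e : nat).

Notation dimv V := (\dim (fullv : {vspace V})).
Notation basisv V := (vbasis (fullv : {vspace V})).

(* The symmetric algebra of V is the polynomial ring in indeterminates 'X_i
   standing for the vectors b_i of the basis [vbasis fullv] of V. The image of
   v in degree 1 is [sym1 v], and [symalg f] is the algebra morphism induced by
   a linear f. S^e V is the homogeneous part of degree e; [sympow_universal]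
   below is its basis-free characterization, with [symprod v] the product
   v_0 ... v_(e-1), and [symmap_symprod] that of the functor action. *)
Definition sym1 V (v : V) : {mpoly K[dimv V]} :=
  \sum_i coord (basisv V) i v *: 'X_i.

Lemma sym1_linear V : linear (@sym1 V).
Proof.
move=> a u v; rewrite /sym1 scaler_sumr -big_split /=.
by apply: eq_bigr => i _; rewrite linearP scalerDl scalerA.
Qed.

HB.instance Definition _ V :=
  GRing.isLinear.Build K V {mpoly K[dimv V]} _ (@sym1 V) (@sym1_linear V).

Lemma sym1_homog V (v : V) : sym1 v \is 1.-homog.
Proof. by apply: rpred_sum => i _; apply: rpredZ; rewrite dhomogX /= mdeg1. Qed.

Lemma sym1_basis V i : sym1 (tnth (basisv V) i) = 'X_i.
Proof.
rewrite /sym1 (bigD1 i) //= big1 => [|j ne_ji];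
  rewrite (tnth_nth 0) coord_free ?(basis_free (vbasisP _)) //.
  by rewrite eqxx scale1r addr0.
by rewrite eq_sym (negPf ne_ji) scale0r.
Qed.

Definition symalg V W (f : V -> W) (p : {mpoly K[dimv V]}) :
    {mpoly K[dimv W]} :=
  p \mPo [tuple sym1 (f (tnth (basisv V) i)) | i < dimv V].

Lemma symalgX V W (f : V -> W) i :
  symalg f 'X_i = sym1 (f (tnth (basisv V) i)).
Proof. by rewrite /symalg comp_mpolyXU -tnth_nth tnth_mktuple. Qed.

Lemma symalg_sym1 V W (f : {linear V -> W}) v : symalg f (sym1 v) = sym1 (f v).
Proof.
rewrite {1}/sym1 /symalg linear_sum /=.
rewrite [in RHS](coord_vbasis (memvf v)) !linear_sum; apply: eq_bigr => i _.
by rewrite comp_mpolyZ -/(symalg f _) symalgX !linearZ (tnth_nth 0).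
Qed.

Lemma symalg_homog V W (f : V -> W) e (p : {mpoly K[dimv V]}) :
  p \is e.-homog -> symalg f p \is e.-homog.
Proof.
move=> /dhomogP hp; rewrite /symalg comp_mpolyEX big_seq.
apply: rpred_sum => m /hp <-; apply: rpredZ; rewrite comp_mpolyX /= mdegE.
elim/big_rec2: _ => [|i d q _ hq]; first exact: dhomog1.
apply: dhomogM => //; rewrite -[X in X.-homog]mul1n; apply: dhomogMn.
by rewrite tnth_mktuple sym1_homog.
Qed.

Definition sympow e V : lmodType K := dhomog (dimv V) K e.

Lemma symprod_subproof e V (v : 'I_e -> V) : \prod_j sym1 (v j) \is e.-homog.
Proof.
rewrite -[X in X.-homog](card_ord e) -sum1_card.
elim/big_rec2: _ => [|j d q _ hq]; first exact: dhomog1.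
by apply: dhomogM => //; apply: sym1_homog.
Qed.

Definition symprod e V (v : 'I_e -> V) : sympow e V :=
  DHomog (symprod_subproof v).

Definition symmap e V W (f : V -> W) (p : sympow e V) : sympow e W :=
  DHomog (symalg_homog f (dhomog_is_dhomog p)).

Lemma symmap_linear e V W (f : V -> W) : linear (@symmap e V W f).
Proof. by move=> a p q; apply: val_inj; rewrite /= /symalg linearP. Qed.

HB.instance Definition _ e V W (f : V -> W) :=
  GRing.isLinear.Build K (sympow e V) (sympow e W) _ (symmap f)
    (@symmap_linear e V W f).

Lemma symmap_symprod e V W (f : {linear V -> W}) (v : 'I_e -> V) :
  symmap f (symprod v) = symprod (f \o v).
Proof.
apply: val_inj => /=; rewrite /symalg rmorph_prod; apply: eq_bigr => j _.
exact: symalg_sym1.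
Qed.

Definition multilinear e V (L : lmodType K) (f : ('I_e -> V) -> L) :=
  forall (v : 'I_e -> V) (j : 'I_e) a x y,
    f [eta v with j |-> a *: x + y] =
      a *: f [eta v with j |-> x] + f [eta v with j |-> y].

Definition symmetric_map e V (L : Type) (f : ('I_e -> V) -> L) :=
  forall (s : 'S_e) (v : 'I_e -> V), f (v \o s) = f v.

Lemma symprod_multilinear e V : multilinear (@symprod e V).
Proof.
move=> v j a x y; apply: val_inj.
have E z : val (symprod [eta v with j |-> z]) =
    sym1 z * \prod_(i | i != j) sym1 (v i).
  rewrite [LHS](bigD1 j) //= eqxx; congr (_ * _).
  by apply: eq_bigr => i /negPf /= ->.
by rewrite E linearP mulrDl -scalerAl -!E.
Qed.

Lemma symprod_symmetric e V : symmetric_map (@symprod e V).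
Proof.
move=> s v; apply: val_inj => /=.
by rewrite [RHS](reindex_inj (@perm_inj _ s)).
Qed.

Lemma multilinear_ext e V (L : lmodType K) (f g : ('I_e -> V) -> L) :
    multilinear f -> multilinear g ->
    (forall h : 'I_e -> 'I_(dimv V),
       f (fun j => tnth (basisv V) (h j)) =
       g (fun j => tnth (basisv V) (h j))) ->
  f =1 g.
Proof.
move=> fl gl fg v.
have sum_ext (f' : ('I_e -> V) -> L) : multilinear f' ->
    forall u j r (P : pred 'I_(dimv V)) c (b : 'I_(dimv V) -> V),
  f' [eta u with j |-> \sum_(i <- r | P i) c i *: b i] =
  \sum_(i <- r | P i) c i *: f' [eta u with j |-> b i].
  move=> fl' u j r P c b.
  have f0 : f' [eta u with j |-> 0] = 0.
    have := fl' u j (-1) 0 0.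
    by rewrite scaler0 add0r scaleN1r addNr.
  elim/big_rec2: _ => // i x y _ <-; exact: fl'.
suff hk k : forall w : 'I_e -> V, (forall j : 'I_e, k <= j ->
    exists i, w j = tnth (basisv V) i)%N -> f w = g w.
  by apply: (hk e) => j; rewrite leqNgt ltn_ord.
elim: k => [|k IHk] w hw.
  have [h /boolp.funext ->] := fin_all_exists (fun j => hw j (leq0n j)).
  exact: fg.
case: (ltnP k e) => [ltke|leek]; last first.
  by apply: IHk => j; rewrite leqNgt (leq_trans (ltn_ord j) leek).
pose j := Ordinal ltke.
have /boolp.funext -> : w =1 [eta w with j |-> \sum_i
    coord (basisv V) i (w j) *: tnth (basisv V) i].
  move=> i /=; case: eqP => // ->; rewrite {1}(coord_vbasis (memvf (w j))).
  by apply: eq_bigr => a _; rewrite (tnth_nth 0).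
rewrite !sum_ext //; apply: eq_bigr => i _.
congr (_ *: _); apply: IHk => a; rewrite leq_eqVlt /=.
case: (a =P j) => [_ _|ne_aj]; first by exists i.
case/predU1P=> [eka|]; last by move=> /hw.
by case: ne_aj; apply: val_inj.
Qed.

Definition idx_mnm n e (h : 'I_e -> 'I_n) : 'X_{1..n} := (\sum_j U_(h j))%MM.

Lemma mdeg_idx n e (h : 'I_e -> 'I_n) : mdeg (idx_mnm h) = e.
Proof.
rewrite mdeg_sum (eq_bigr (fun=> 1%N)) => [|j _]; last exact: mdeg1.
by rewrite sum1_card card_ord.
Qed.

Lemma idx_mnm_surj n e (m : 'X_{1..n}) :
  mdeg m = e -> exists h : {ffun 'I_e -> 'I_n}, idx_mnm h = m.
Proof.
elim: e m => [|e IHe] m dm.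
  have /eqP -> : m == 0%MM by rewrite -mdeg_eq0 dm.
  exists [ffun j : 'I_0 => match notF (ltn_ord j) with end].
  by rewrite /idx_mnm big_ord0.
have [i mi] : exists i, m i != 0%N.
  apply/existsP; apply: contraTT isT => /existsPn m0.
  move: dm; rewrite mdegE big1 // => i _.
  by apply/eqP; have := m0 i; rewrite negbK.
have le1 : (U_(i) <= m)%MM by rewrite lep1mP.
have [|h hE] := IHe (m - U_(i))%MM.
  by apply/eqP; rewrite -(eqn_add2r 1) -{1}(mdeg1 i) -mdegD submK // dm addn1.
exists [ffun j => if unlift ord0 j is Some j' then h j' else i].
rewrite /idx_mnm big_ord_recl ffunE unlift_none.
under eq_bigr => j _ do rewrite ffunE liftK.
by rewrite -/(idx_mnm h) hE addmC submK.
Qed.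

Lemma idx_mnm_perm n e (h h' : {ffun 'I_e -> 'I_n}) :
  idx_mnm h = idx_mnm h' -> exists s : 'S_e, h =1 h' \o s.
Proof.
move=> hh'; pose t (k : {ffun 'I_e -> 'I_n}) := [tuple k j | j < e].
have : perm_eq (t h) (t h').
  apply/allP => i _ /=; apply/eqP.
  have cnt (k : {ffun 'I_e -> 'I_n}) : count_mem i (t k) = idx_mnm k i.
    rewrite /idx_mnm mnm_sumE count_map /= -sum1_count big_mkcond /=.
    by rewrite big_enum /=; apply: eq_bigr => j _; rewrite mnm1E; case: eqP.
  by rewrite -!/(t _) !cnt hh'.
case/tuple_permP => s /val_inj ths; exists s => j /=.
by have := congr1 (fun u => tnth u j) ths; rewrite !tnth_mktuple.
Qed.

Lemma symprod_idx e V (h : 'I_e -> 'I_(dimv V)) :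
  symprod (fun j => tnth (basisv V) (h j)) =
  'X_[idx_mnm h] :> {mpoly K[dimv V]}.
Proof.
rewrite /= /idx_mnm; under eq_bigr => j _ do rewrite sym1_basis.
by rewrite mprodXE.
Qed.

Lemma sympow_linear_ext e V (L : lmodType K)
    (g g' : {linear sympow e V -> L}) :
  (forall v, g (symprod v) = g' (symprod v)) -> g =1 g'.
Proof.
move=> gg' p; have /dhomogP hp := dhomog_is_dhomog p.
have [q qE] : exists q : seq (K * {ffun 'I_e -> 'I_(dimv V)}),
    p = \sum_(ch <- q) ch.1 *: symprod (fun j => tnth (basisv V) (ch.2 j)).
  have hs (m : 'X_{1..dimv V}) : m \in msupp (val p) ->
      exists h : {ffun 'I_e -> 'I_(dimv V)}, idx_mnm h == m.
    by move=> /hp/idx_mnm_surj[h <-]; exists h.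
  have [q qE] : exists q : seq (K * {ffun 'I_e -> 'I_(dimv V)}),
      val p = \sum_(ch <- q) ch.1 *: 'X_[idx_mnm ch.2].
    rewrite [val p]mpolyE; elim: (msupp _) hs => [|m r IHr] hs.
      by exists [::]; rewrite !big_nil.
    have [h /eqP hE] := hs m (mem_head _ _).
    have [|q qE] := IHr.
      by move=> m' m'r; apply: hs; rewrite inE m'r orbT.
    by exists (((val p)@_m, h) :: q); rewrite !big_cons qE hE.
  exists q; apply: val_inj; rewrite qE raddf_sum; apply: eq_bigr => ch _.
  by rewrite -symprod_idx.
by rewrite qE !linear_sum; apply: eq_bigr => ch _; rewrite !linearZ gg'.
Qed.

Theorem sympow_universal e V (L : lmodType K) (f : ('I_e -> V) -> L) :
    multilinear f -> symmetric_map f ->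
  exists2 g : {linear sympow e V -> L}, (forall v, g (symprod v) = f v) &
    forall g' : {linear sympow e V -> L},
      (forall v, g' (symprod v) = f v) -> g' =1 g.
Proof.
move=> fl fs.
pose M (m : 'X_{1..dimv V}) : L :=
  if [pick h : {ffun 'I_e -> 'I_(dimv V)} | idx_mnm h == m] is Some h
  then f (fun j => tnth (basisv V) (h j)) else 0.
have ME (h : 'I_e -> 'I_(dimv V)) :
    M (idx_mnm h) = f (fun j => tnth (basisv V) (h j)).
  pose h1 := finfun h.
  have hh1 : h1 =1 h by move=> j; rewrite ffunE.
  have mE : idx_mnm h = idx_mnm h1.
    by apply: eq_bigr => j _; rewrite hh1.
  rewrite /M; case: pickP => [h' /eqP|/(_ h1)]; last by rewrite mE eqxx.
  rewrite mE => /idx_mnm_perm[s hs].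
  by rewrite -[RHS](fs s); congr f; apply/boolp.funext => j; rewrite hs /= hh1.
pose g (p : sympow e V) : L := \sum_(m : 'X_{1..(dimv V) < e.+1}) p@_m *: M m.
have gl : linear g.
  move=> a p q; rewrite /g scaler_sumr -big_split; apply: eq_bigr => m _ /=.
  by rewrite mcoeffD mcoeffZ scalerDl scalerA.
pose g1 : {linear sympow e V -> L} :=
  HB.pack g (GRing.isLinear.Build K (sympow e V) L _ g gl).
have gE v : g1 (symprod v) = f v.
  apply: (@multilinear_ext _ _ _ (fun w => g1 (symprod w)) f) => //.
    by move=> {}v j a x y; rewrite symprod_multilinear linearP.
  move=> h; rewrite -ME /= /g.
  have lt_h : (mdeg (idx_mnm h) < e.+1)%N by rewrite mdeg_idx.
  rewrite symprod_idx (bigD1 (BMultinom lt_h)) //= mcoeffX eqxx scale1r.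
  rewrite big1 ?addr0 // => m /negPf ne_m; rewrite mcoeffX.
  by rewrite eq_sym -val_eqE /= in ne_m; rewrite ne_m scale0r.
exists g1 => // g' g'E; apply: sympow_linear_ext => v.
by rewrite g'E gE.
Qed.

Lemma symmap_id e V : @symmap e V V idfun =1 id.
Proof.
apply: (@sympow_linear_ext _ _ _ _ idfun) => v /=.
by rewrite (symmap_symprod idfun).
Qed.

Lemma symmap_comp e V W U (g : {linear W -> U}) (f : {linear V -> W}) :
  @symmap e V U (g \o f) =1 symmap g \o symmap f.
Proof.
apply: (@sympow_linear_ext _ _ _ _ (symmap g \o symmap f)) => v /=.
by rewrite !symmap_symprod.
Qed.

End Sym.
End SymmetricPower.

Import SymmetricPower.
From mathcomp Require Import all_classical topology.
Local Open Scope classical_set_scope.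

Section DirectSum.
Variables (I : finType) (R : nzRingType) (T : I -> lmodType R).

Definition dsum := {dffun forall i, T i}.

HB.instance Definition _ := Choice.on dsum.

Implicit Types x y z : dsum.

Definition dsum0 : dsum := [ffun i => 0 : T i].
Definition dsumN x : dsum := [ffun i => - x i : T i].
Definition dsumD x y : dsum := [ffun i => x i + y i : T i].
Definition dsumZ (a : R) x : dsum := [ffun i => a *: x i : T i].

Fact dsumA : associative dsumD.
Proof. by move=> x y z; apply/ffunP=> i; rewrite !ffunE addrA. Qed.
Fact dsumC : commutative dsumD.
Proof. by move=> x y; apply/ffunP=> i; rewrite !ffunE addrC. Qed.
Fact dsum0l : left_id dsum0 dsumD.
Proof. by move=> x; apply/ffunP=> i; rewrite !ffunE add0r. Qed.
Fact dsumNl : left_inverse dsum0 dsumN dsumD.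
Proof. by move=> x; apply/ffunP=> i; rewrite !ffunE addNr. Qed.

HB.instance Definition _ :=
  GRing.isZmodule.Build dsum dsumA dsumC dsum0l dsumNl.

Fact dsumZA a b x : dsumZ a (dsumZ b x) = dsumZ (a * b) x.
Proof. by apply/ffunP=> i; rewrite !ffunE scalerA. Qed.
Fact dsumZ1 : left_id 1 dsumZ.
Proof. by move=> x; apply/ffunP=> i; rewrite !ffunE scale1r. Qed.
Fact dsumZDr : right_distributive dsumZ +%R.
Proof. by move=> a x y; apply/ffunP=> i; rewrite !ffunE scalerDr. Qed.
Fact dsumZDl x : {morph dsumZ^~ x : a b / a + b}.
Proof. by move=> a b; apply/ffunP=> i; rewrite !ffunE scalerDl. Qed.

HB.instance Definition _ :=
  GRing.Zmodule_isLmodule.Build R dsum dsumZA dsumZ1 dsumZDr dsumZDl.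

End DirectSum.

Section Zariski.
Variables (K : fieldType) (W : lmodType K).

(* The subalgebra of K^W generated by the dual of W; on a finite-dimensional W
   these are the polynomials in the coordinates with respect to a basis. *)
Inductive polynomial_function : (W -> K) -> Prop :=
| polyfun_cst c : polynomial_function (fun=> c)
| polyfun_lin (l : {linear W -> K^o}) : polynomial_function l
| polyfun_add f g : polynomial_function f -> polynomial_function g ->
    polynomial_function (fun w => f w + g w)
| polyfun_mul f g : polynomial_function f -> polynomial_function g ->
    polynomial_function (fun w => f w * g w).

Definition zero_locus (F : set (W -> K)) : set W :=
  [set w | forall f, F f -> f w = 0].

Definition zariski_closed (A : set W) : Prop :=
  exists2 F, F `<=` polynomial_function & A = zero_locus F.

Definition zariski : Type := W.

Let zop : set_system zariski := [set A | zariski_closed (~` A)].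

Let zopT : zop setT.
Proof.
exists [set fun=> 1] => [_ ->|]; first exact: polyfun_cst.
rewrite setCT; apply/seteqP; split=> // w /(_ _ erefl) /eqP.
by rewrite oner_eq0.
Qed.

Let zopI : setI_closed zop.
Proof.
move=> A B [F Fp AF] [G Gp BG]; rewrite /zop /= setCI AF BG.
exists [set h | exists f g, [/\ F f, G g & h = fun w => f w * g w]].
  by move=> _ [f [g [/Fp pf /Gp pg ->]]]; exact: polyfun_mul.
apply/seteqP; split=> w.
  by case=> [Fw|Gw] _ [f [g [Ff Gg ->]]];
    rewrite ?(Fw _ Ff) ?(Gw _ Gg) ?mul0r ?mulr0.
move=> FGw; apply: contrapT => /not_orP[/existsNP[f /not_implyP[Ff fw]]].
move=> /existsNP[g /not_implyP[Gg gw]].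
have /eqP := FGw _ (ex_intro _ f (ex_intro _ g (And3 Ff Gg erefl))).
by rewrite mulf_eq0 => /orP[] /eqP.
Qed.

Let zop_bigU (I : Type) (A : I -> set zariski) :
  (forall i, zop (A i)) -> zop (\bigcup_i A i).
Proof.
move=> Aop; rewrite /zop /= setC_bigcup.
exists [set f | polynomial_function f /\
          exists i, forall w, (~` A i) w -> f w = 0]; first by move=> f [].
apply/seteqP; split=> w.
  by move=> Aw f [_ [i]]; apply; exact: Aw.
move=> Fw i _; have [F Fp AF] := Aop i; rewrite AF => f Ff.
apply: Fw; split; first exact: Fp.
by exists i => v; rewrite AF; exact.
Qed.

HB.instance Definition _ := Choice.on zariski.
HB.instance Definition _ := isOpenTopological.Build zariski zopT zopI zop_bigU.

Lemma closed_zariskiE (A : set zariski) : closed A <-> zariski_closed A.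
Proof.
rewrite -{2}(setCK A); split=> [/closed_openC //|Ac].
by rewrite -(setCK A); apply: open_closedC.
Qed.

End Zariski.

Section PolynomialFunctor.
Variables (K : fieldType) (k : nat) (d : 'I_k -> nat).
Implicit Types V W U : vectType K.

Definition symsum V : lmodType K := dsum (fun i => sympow (d i) V).

Definition symsum_map V W (f : {linear V -> W}) (x : symsum V) : symsum W :=
  [ffun i => symmap f (x i) : sympow (d i) W].

Lemma symsum_map_id V : symsum_map (idfun : {linear V -> V}) =1 id.
Proof. by move=> x; apply/ffunP => i; rewrite ffunE symmap_id. Qed.

Lemma symsum_map_comp V W U (g : {linear W -> U}) (f : {linear V -> W}) :
  symsum_map (g \o f) =1 symsum_map g \o symsum_map f.
Proof. by move=> x; apply/ffunP => i; rewrite !ffunE symmap_comp. Qed.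

Lemma eq_symsum_map V W (f g : {linear V -> W}) :
  f =1 g -> symsum_map f =1 symsum_map g.
Proof.
by move=> /funext fg x; apply/ffunP => i; rewrite !ffunE /symmap fg.
Qed.

Notation ZP V := (zariski (symsum V)).

Definition closed_Vec_subspace (X : forall V, set (ZP V)) : Prop :=
  (forall V, closed (X V)) /\
  (forall V W (f : {linear V -> W}), symsum_map f @` X V `<=` X W).

Definition Vec_noetherian : Prop :=
  forall X : nat -> forall V, set (ZP V),
    (forall n, closed_Vec_subspace (X n)) ->
    (forall n V, X n.+1 V `<=` X n V) ->
    exists N, forall n, (N <= n)%N -> forall V, X n V = X N V.

Definition first_coords m n (le_mn : (m <= n)%N) : 'cV[K]_n -> 'cV[K]_m :=
  rowsub (widen_ord le_mn).

HB.instance Definition _ m n (le_mn : (m <= n)%N) :=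
  GRing.Linear.copy (first_coords le_mn) (rowsub (widen_ord le_mn)).

Definition symsum_limit_set :
    set (prod_topology (fun n => ZP 'cV[K]_n)) :=
  [set x | forall n, symsum_map (first_coords (leqnSn n)) (x n.+1) = x n].

(* The inverse-limit topology: the subspace topology on [set_type] of the
   product of the Zariski topologies. *)
Definition symsum_limit : topologicalType := set_type symsum_limit_set.

Lemma symsum_limit_trunc (x : symsum_limit) m n (le_mn : (m <= n)%N) :
  symsum_map (first_coords le_mn) (val x n) = val x m.
Proof.
have /set_mem xlim := valP x.
have trunc_id p (le_pp : (p <= p)%N) : first_coords le_pp =1 idfun.
  by move=> v; apply/matrixP => i j; rewrite mxE; congr (v _ _); apply: val_inj.
elim: n => [|n IHn] in le_mn *.
  have m0 : m = 0%N by apply/eqP; rewrite -leqn0.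
  by subst m; rewrite (eq_symsum_map (trunc_id _ _)) symsum_map_id.
have [le_mn'|] := leqP m n; last first.
  move=> lt_nm; have mS : m = n.+1 by apply/eqP; rewrite eqn_leq le_mn.
  by subst m; rewrite (eq_symsum_map (trunc_id _ _)) symsum_map_id.
have tE : first_coords le_mn =1 first_coords le_mn' \o first_coords (leqnSn n).
  move=> v; apply/matrixP => i j; rewrite /= !mxE.
  by congr (v _ _); apply: val_inj.
by rewrite (eq_symsum_map tE) symsum_map_comp /= xlim IHn.
Qed.

Definition diag1 n m (g : 'M[K]_n) : 'M[K]_(n + m) := block_mx g 0 0 1%:M.

Lemma diag1_trunc n (g : 'M[K]_n) m p (le_mp : (m <= p)%N)
    (le_nmp : (n + m <= n + p)%N) :
  first_coords le_nmp \o mulmx (diag1 p g) =1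
  mulmx (diag1 m g) \o first_coords le_nmp.
Proof.
move=> v /=; rewrite -[v]vsubmxK; set a := usubmx v; set b := dsubmx v.
have E q (le_nq : (n + q <= n + p)%N) (le_qp : (q <= p)%N) (c : 'cV[K]_n) :
    first_coords le_nq (col_mx c b) = col_mx c (first_coords le_qp b).
  apply/matrixP => i j; rewrite mxE; case: (split_ordP i) => i' ->.
    rewrite col_mxEu -(col_mxEu c b); congr (col_mx c b _ _).
    exact: val_inj.
  rewrite col_mxEd [RHS]mxE -(col_mxEd c b); congr (col_mx c b _ _).
  exact: val_inj.
rewrite /diag1 mul_block_col !mul0mx mul1mx addr0 add0r !(E _ _ le_mp).
by rewrite mul_block_col !mul0mx mul1mx addr0 add0r.
Qed.

(* The component of g x in P(K^m) is read off in P(K^(n + m)), where g in GL_n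
   acts as diag(g, 1); see [GL_actE]. *)
Definition GL_act_fun n (g : 'M[K]_n) (x : symsum_limit) m : ZP 'cV[K]_m :=
  symsum_map (first_coords (leq_addl n m))
    (symsum_map (mulmx (diag1 m g)) (val x (n + m)%N)).

Lemma GL_act_trunc n (g : 'M[K]_n) (x : symsum_limit) m p (le_mp : (m <= p)%N)
    (le_mnp : (m <= n + p)%N) :
  symsum_map (first_coords le_mnp)
    (symsum_map (mulmx (diag1 p g)) (val x (n + p)%N)) = GL_act_fun g x m.
Proof.
have le_nmp : (n + m <= n + p)%N by rewrite leq_add2l.
rewrite /GL_act_fun -(symsum_limit_trunc x le_nmp).
have tE : first_coords le_mnp =1
    first_coords (leq_addl n m) \o first_coords le_nmp.
  move=> v; apply/matrixP => i j; rewrite /= !mxE.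
  by congr (v _ _); apply: val_inj.
rewrite (eq_symsum_map tE) symsum_map_comp /=; congr (symsum_map _ _).
have := eq_symsum_map (diag1_trunc g le_mp le_nmp) (val x (n + p)%N).
by rewrite !symsum_map_comp.
Qed.

Lemma GL_act_subproof n (g : 'M[K]_n) (x : symsum_limit) :
  GL_act_fun g x \in symsum_limit_set.
Proof.
apply/mem_set => m /=.
have le_m : (m <= n + m.+1)%N by rewrite (leq_trans (leqnSn m)) ?leq_addl.
rewrite -(GL_act_trunc g x (leqnSn m) le_m) /GL_act_fun.
rewrite -[LHS]/((symsum_map _ \o symsum_map _) _) -symsum_map_comp.
apply: eq_symsum_map => v; apply/matrixP => i j; rewrite /= !mxE.
by congr (_ _ _ _); apply: val_inj.
Qed.

Definition GL_act n (g : 'M[K]_n) (x : symsum_limit) : symsum_limit :=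
  exist _ (GL_act_fun g x) (GL_act_subproof g x).

Lemma GL_actE n (g : 'M[K]_n) (x : symsum_limit) m :
  val (GL_act g x) (n + m)%N =
  symsum_map (mulmx (diag1 m g)) (val x (n + m)%N).
Proof.
rewrite -[in RHS](symsum_limit_trunc x (leq_addl n (n + m))).
rewrite -[RHS]/((symsum_map _ \o symsum_map _) _) -symsum_map_comp.
rewrite -[LHS]/((symsum_map _ \o symsum_map _) _) -symsum_map_comp.
by apply: eq_symsum_map; apply: diag1_trunc; apply: leq_addl.
Qed.

Definition GL_stable (Y : set symsum_limit) : Prop :=
  forall n (g : 'M[K]_n), g \in unitmx -> GL_act g @` Y `<=` Y.

Definition GL_noetherian : Prop :=
  forall Y : nat -> set symsum_limit,
    (forall n, closed (Y n) /\ GL_stable (Y n)) ->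
    (forall n, Y n.+1 `<=` Y n) ->
    exists N, forall n, (N <= n)%N -> Y n = Y N.

End PolynomialFunctor.

(* Main.v *)
Require Import Defs.
From HB Require Import structures.
From mathcomp Require Import all_boot all_order all_algebra all_classical.
From mathcomp Require Import topology.
From mathcomp Require mpoly.

(* This is Draisma's argument, phrased with "bad sequences": polynomials f_i on
   P(K^(n_i)) and points p_i in P(K^(n_i)) with f_i(p_i) <> 0 and f_i vanishing
   on P(phi) p_j for all j > i and all linear phi. Such sequences pass to field
   extensions, so K may be taken perfect, and from the S^d to tensor powers.

   That a polynomial functor P of degree at most D has no bad sequence is proved
   by induction on D and on the dimension of the degree D part of P(K^D), the
   case D = 0 being Hilbert's basis theorem. Let R be a minimal nonzero
   subfunctor of the degree D part; P / R has no bad sequence by induction. So,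
   starting from a bad sequence in P, one may choose one for which the ideal of
   its R-invariant equations is maximal, and then an equation f of minimal
   degree among those not forced by the R-invariant ones. Some (Hasse)
   derivative of f along R is additive in its direction and nonzero at images in
   P(U) of infinitely many p_i. Comparing the leading coefficients in t of
   f(P(id_U + t phi) x) for x in P(U + V) then determines (up to Frobenius) the
   component of x in R(V) in terms of the other components, because the
   annihilators of these linear conditions form a subfunctor of R. Eliminating
   that component yields a bad sequence in P(U + _) / R, against the induction
   hypothesis. *)

Set Implicit Arguments.
Unset Strict Implicit.
Unset Printing Implicit Defensive.

Import Order.TTheory GRing.Theory.
Local Open Scope classical_set_scope.
Local Open Scope ring_scope.

(** * Polynomial functions *)

(** Infinitude in the form that root counting consumes; it passes along injective maps, hence to
    extension fields. *)
Definition many_elements (K : fieldType) :=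
  forall n, exists2 s : seq K, uniq s & size s = n.

Lemma infinite_many_elements (K : fieldType) :
  infinite_set [set: K] -> many_elements K.
Proof.
move=> /infiniteP/card_leP[g] n.
pose h (i : nat) := set_val (g (SigSub (in_setT i))).
exists [seq h i | i <- iota 0 n]; last by rewrite size_map size_iota.
rewrite map_inj_in_uniq ?iota_uniq // => i j _ _ /val_inj.
by move=> /inj-/(_ _ _)/(congr1 set_val); apply; rewrite inE.
Qed.

Lemma poly_ext_in (L : fieldType) (A : set L) (p q : {poly L}) :
    (forall n, exists s : seq L,
       [/\ uniq s, size s = n & forall t, t \in s -> A t]) ->
    (forall t, A t -> p.[t] = q.[t]) ->
  p = q.
Proof.
move=> Ainf pq; apply/eqP; rewrite -subr_eq0; apply: contraT => nz.
have [s [us szs sA]] := Ainf (size (p - q)).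
have /(max_poly_roots nz)/(_ us) : all (root (p - q)) s.
  apply/allP => t /sA At.
  by rewrite rootE hornerD hornerN pq // subrr.
by rewrite szs ltnn.
Qed.

Lemma poly_ext (K : fieldType) (p q : {poly K}) :
  many_elements K -> (forall t, p.[t] = q.[t]) -> p = q.
Proof.
move=> Kinf pq; apply: (@poly_ext_in _ setT) => [n|t _]; last exact: pq.
by have [s us ss] := Kinf n; exists s; split.
Qed.

Section PolynomialFunctions.
Variable K : fieldType.
Implicit Types W Y : lmodType K.

(* [pf n f]: f is a polynomial function of degree at most n. *)
Inductive pf W : nat -> (W -> K) -> Prop :=
| pf_cst c : pf 0 (fun=> c)
| pf_lin (l : {linear W -> K^o}) : pf 1 l
| pf_add n f g : pf n f -> pf n g -> pf n (fun w => f w + g w)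
| pf_mul m n f g : pf m f -> pf n g -> pf (m + n) (fun w => f w * g w)
| pf_le m n f : (m <= n)%N -> pf m f -> pf n f.

Definition polyf W (f : W -> K) := exists n, pf n f.

Lemma eq_pf W n (f g : W -> K) : pf n f -> f =1 g -> pf n g.
Proof. by move=> pff /funext <-. Qed.

Lemma eq_polyf W (f g : W -> K) : polyf f -> f =1 g -> polyf g.
Proof. by move=> pff /funext <-. Qed.

Lemma pf_cst_le W n c : pf n (fun _ : W => c).
Proof. by apply: pf_le (pf_cst _ _). Qed.

Lemma pf_sum W n (I : Type) (r : seq I) (P : pred I) (F : I -> W -> K) :
  (forall i, P i -> pf n (F i)) -> pf n (fun w => \sum_(i <- r | P i) F i w).
Proof.
move=> pF; elim: r => [|i r IHr].
  by apply: eq_pf (pf_cst_le _ _ 0) _ => w; rewrite big_nil.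
case Pi: (P i).
  by apply: eq_pf (pf_add (pF i Pi) IHr) _ => w; rewrite big_cons Pi.
by apply: eq_pf IHr _ => w; rewrite big_cons Pi.
Qed.

Lemma pf_scale W n a f : @pf W n f -> pf n (fun w => a * f w).
Proof. by move=> pff; rewrite -(add0n n); exact: pf_mul (pf_cst _ _) pff. Qed.

Lemma pf0 W (f : W -> K) : pf 0 f -> forall x y, f x = f y.
Proof.
suff H n : pf n f -> n = 0%N -> forall x y, f x = f y by move=> /H; apply.
elim=> {n f}.
- by [].
- by [].
- by move=> n f g _ IHf _ IHg n0 x y; rewrite (IHf n0 x y) (IHg n0 x y).
- move=> m n f g _ IHf _ IHg /eqP; rewrite addn_eq0 => /andP[/eqP m0 /eqP n0].
  by move=> x y; rewrite (IHf m0 x y) (IHg n0 x y).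
- by move=> m n f lemn _ IHf n0; apply: IHf; apply/eqP; rewrite -leqn0 -n0.
Qed.

Lemma pf_affine W Y n (f : W -> K) (l : {linear Y -> W}) w :
  pf n f -> pf n (fun y => f (w + l y)).
Proof.
elim=> {n f} [c|g|n f g _ + _|m n f g _ + _|m n f lemn _].
- exact: pf_cst.
- apply: eq_pf (pf_add (pf_cst_le _ _ (g w)) (pf_lin (g \o l))) _ => y /=.
  by rewrite linearD.
- exact: pf_add.
- exact: pf_mul.
- exact: pf_le.
Qed.

Lemma pf_comp W Y n (f : W -> K) (l : {linear Y -> W}) :
  pf n f -> pf n (fun y => f (l y)).
Proof.
by move=> /(pf_affine l 0) pff; apply: eq_pf pff _ => y; rewrite add0r.
Qed.

Lemma polyf_cst W c : polyf (fun _ : W => c).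
Proof. by exists 0%N; exact: pf_cst. Qed.

Lemma polyf_lin W (l : {linear W -> K^o}) : polyf l.
Proof. by exists 1%N; exact: pf_lin. Qed.

Lemma polyf_add W (f g : W -> K) :
  polyf f -> polyf g -> polyf (fun w => f w + g w).
Proof.
move=> [m pff] [n pg]; exists (maxn m n); apply: pf_add.
  by apply: pf_le pff; exact: leq_maxl.
by apply: pf_le pg; exact: leq_maxr.
Qed.

Lemma polyf_mul W (f g : W -> K) :
  polyf f -> polyf g -> polyf (fun w => f w * g w).
Proof. by move=> [m pff] [n pg]; exists (m + n)%N; exact: pf_mul. Qed.

Lemma polyf_exp W (f : W -> K) n : polyf f -> polyf (fun w => f w ^+ n).
Proof.
move=> pff; elim: n => [|n IHn]; first exact: polyf_cst.
by apply: eq_polyf (polyf_mul pff IHn) _ => w; rewrite exprS.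
Qed.

Lemma polyf_sum W (I : Type) (r : seq I) (P : pred I) (F : I -> W -> K) :
  (forall i, P i -> polyf (F i)) -> polyf (fun w => \sum_(i <- r | P i) F i w).
Proof.
move=> pF; elim: r => [|i r IHr].
  by apply: eq_polyf (polyf_cst _ 0) _ => w; rewrite big_nil.
case Pi: (P i).
  by apply: eq_polyf (polyf_add (pF i Pi) IHr) _ => w; rewrite big_cons Pi.
by apply: eq_polyf IHr _ => w; rewrite big_cons Pi.
Qed.

Lemma polyf_prod W (I : Type) (r : seq I) (P : pred I) (F : I -> W -> K) :
  (forall i, P i -> polyf (F i)) -> polyf (fun w => \prod_(i <- r | P i) F i w).
Proof.
move=> pF; elim: r => [|i r IHr].
  by apply: eq_polyf (polyf_cst _ 1) _ => w; rewrite big_nil.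
case Pi: (P i).
  by apply: eq_polyf (polyf_mul (pF i Pi) IHr) _ => w; rewrite big_cons Pi.
by apply: eq_polyf IHr _ => w; rewrite big_cons Pi.
Qed.

Lemma polyf_affine W Y (f : W -> K) (l : {linear Y -> W}) w :
  polyf f -> polyf (fun y => f (w + l y)).
Proof. by move=> [n pff]; exists n; exact: pf_affine. Qed.

Lemma polyf_comp W Y (f : W -> K) (l : {linear Y -> W}) :
  polyf f -> polyf (fun y => f (l y)).
Proof. by move=> [n pff]; exists n; exact: pf_comp. Qed.

Lemma polyf_det W n (M : W -> 'M[K]_n) :
  (forall i j, polyf (fun w => M w i j)) -> polyf (fun w => \det (M w)).
Proof.
move=> pM; apply: polyf_sum => s _; apply: polyf_mul.
  exact: polyf_cst.
by apply: polyf_prod => i _; exact: pM.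
Qed.

Lemma polyf_adj W n (M : W -> 'M[K]_n) :
    (forall i j, polyf (fun w => M w i j)) ->
  forall i j, polyf (fun w => (\adj (M w)) i j).
Proof.
move=> pM i j.
have pd : polyf (fun w => cofactor (M w) j i).
  apply: polyf_mul; first exact: polyf_cst.
  apply: polyf_det => a b.
  by apply: eq_polyf (pM (lift j a) (lift i b)) _ => w; rewrite !mxE.
by apply: eq_polyf pd _ => w; rewrite mxE.
Qed.

(* The k-th coefficient of [F x v] is the k-th Hasse derivative of f at x in
   the direction v. *)
Lemma hasse_expansion W n (f : W -> K) : pf n f ->
  exists F : W -> W -> {poly K},
    [/\ forall x v s, (F x v).[s] = f (x + s *: v),
        forall x v, (size (F x v) <= n.+1)%N,
        forall v k, pf (n - k) (fun x => (F x v)`_k) &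
        forall x k, pf k (fun v => (F x v)`_k)].
Proof.
elim=> {n f} [c|l|n f g _ [F [F1 F2 F3 F4]] _ [G [G1 G2 G3 G4]]
  |m n f g _ [F [F1 F2 F3 F4]] _ [G [G1 G2 G3 G4]]
  |m n f lemn _ [F [F1 F2 F3 F4]]].
- exists (fun _ _ => c%:P); split => [x v s|x v|v k|x k]; rewrite ?hornerC //.
  + by rewrite size_polyC; case: eqP.
  + exact: pf_cst_le.
  + exact: pf_cst_le.
- exists (fun x v => (l x)%:P + (l v : K) *: 'X).
  split => [x v s|x v|v k|x k].
  + by rewrite !hornerE linearD linearZ /= mulrC.
  + rewrite (leq_trans (size_polyD _ _)) // geq_max.
    rewrite (leq_trans (size_polyC_leq1 _)) //.
    by rewrite (leq_trans (size_scale_leq _ _)) // size_polyX.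
  + case: k => [|k].
      apply: eq_pf (pf_lin l) _ => x /=.
      by rewrite coefD coefC coefZ coefX mulr0 addr0.
    apply: eq_pf (pf_cst_le _ _ ((l v : K) * (k.+1 == 1%N)%:R)) _ => x.
    by rewrite coefD coefC coefZ coefX add0r.
  + case: k => [|k].
      apply: eq_pf (pf_cst _ (l x)) _ => v /=.
      by rewrite coefD coefC coefZ coefX mulr0 addr0.
    apply: pf_le (isT : (1 <= k.+1)%N) _.
    apply: eq_pf (pf_scale (k.+1 == 1%N)%:R (pf_lin l)) _ => v /=.
    by rewrite coefD coefC coefZ coefX add0r mulrC.
- exists (fun x v => F x v + G x v); split => [x v s|x v|v k|x k].
  + by rewrite hornerD F1 G1.
  + by rewrite (leq_trans (size_polyD _ _)) // geq_max F2 G2.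
  + by apply: eq_pf (pf_add (F3 v k) (G3 v k)) _ => x; rewrite coefD.
  + by apply: eq_pf (pf_add (F4 x k) (G4 x k)) _ => v; rewrite coefD.
- exists (fun x v => F x v * G x v); split => [x v s|x v|v k|x k].
  + by rewrite hornerM F1 G1.
  + rewrite (leq_trans (size_polyMleq _ _)) // -subn1 leq_subLR.
    rewrite (leq_trans (leq_add (F2 x v) (G2 x v))) //.
    by rewrite addSn addnS add1n.
  (* A summand vanishes unless [i <= m] and [k - i <= n]; only then do the truncated subtractions
     add up to [m + n - k]. *)
  + have pk : pf (m + n - k)
        (fun x => \sum_(i < k.+1) (F x v)`_i * (G x v)`_(k - i)).
      apply: pf_sum => i _; case: (leqP i m) => im; last first.
        apply: eq_pf (pf_cst_le _ _ 0) _ => x.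
        by rewrite [(F x v)`_i]nth_default ?mul0r // (leq_trans (F2 _ _)).
      case: (leqP (k - i) n) => kin; last first.
        apply: eq_pf (pf_cst_le _ _ 0) _ => x.
        by rewrite [(G x v)`_(k - i)]nth_default ?mulr0 // (leq_trans (G2 _ _)).
      have -> : (m + n - k = (m - i) + (n - (k - i)))%N.
        have ik : (i <= k)%N by rewrite -ltnS.
        by rewrite addnBA // addnBAC // -subnDA subnKC.
      exact: pf_mul.
    by apply: eq_pf pk _ => x; rewrite coefM.
  + have pk : pf k (fun v => \sum_(i < k.+1) (F x v)`_i * (G x v)`_(k - i)).
      apply: pf_sum => i _.
      rewrite -{1}(subnKC (_ : i <= k)%N); last by rewrite -ltnS.
      exact: pf_mul.
    by apply: eq_pf pk _ => v; rewrite coefM.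
- exists F; split => // [x v|v k].
  + by rewrite (leq_trans (F2 x v)).
  + by apply: pf_le (F3 v k); rewrite leq_sub2r.
Qed.

(** This allows a coefficient in t of f along a polynomial curve, depending linearly on y, to serve
    as an equation in y. *)
Lemma pf_curve W Y (f : W -> K) J (c : nat -> {linear Y -> W}) : polyf f ->
  exists F : Y -> {poly K},
    (forall y t, (F y).[t] = f (\sum_(j < J) t ^+ j *: c j y)) /\
    (forall k, polyf (fun y => (F y)`_k)).
Proof.
move=> [n]; elim=> {n f} [a|l|n f g _ [F [F1 F2]] _ [G [G1 G2]]
  |m n f g _ [F [F1 F2]] _ [G [G1 G2]]|//].
- exists (fun=> a%:P); split=> [y t|k]; first by rewrite hornerC.
  by apply: polyf_cst.
- exists (fun y => \poly_(j < J) (l (c j y) : K)); split=> [y t|k].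
    rewrite horner_poly linear_sum; apply: eq_bigr => j _.
    by rewrite linearZ mulrC.
  have pl : polyf (fun y => if (k < J)%N then (l (c k y) : K) else 0).
    case: (k < J)%N; last exact: polyf_cst.
    exact: (polyf_comp (c k) (polyf_lin l)).
  by apply: eq_polyf pl _ => y; rewrite coef_poly.
- exists (fun y => F y + G y); split=> [y t|k]; first by rewrite hornerD F1 G1.
  by apply: eq_polyf (polyf_add (F2 k) (G2 k)) _ => y; rewrite coefD.
- exists (fun y => F y * G y); split=> [y t|k]; first by rewrite hornerM F1 G1.
  have pk : polyf (fun y => \sum_(i < k.+1) (F y)`_i * (G y)`_(k - i)).
    by apply: polyf_sum => i _; exact: polyf_mul.
  by apply: eq_polyf pk _ => y; rewrite coefM.
Qed.

Hypothesis Kinf : many_elements K.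

(** Expanding at 0 writes f as the sum of its homogeneous components; the bound on the size in t
    kills the component of degree n + 1. *)
Lemma pf_lower W n (f : W -> K) :
    pf n.+1 f ->
    (forall w, exists2 p : {poly K}, (size p <= n.+1)%N &
       forall t, p.[t] = f (t *: w)) ->
  pf n f.
Proof.
move=> /hasse_expansion[F [F1 F2 F3 F4]] fsmall.
have F0 w : (size (F 0%R w) <= n.+1)%N.
  have [p szp pE] := fsmall w; suff -> : F 0 w = p by [].
  by apply: poly_ext => // t; rewrite F1 pE add0r.
have pS : pf n (fun w => \sum_(k < n.+1) (F 0 w)`_k).
  by apply: pf_sum => k _; apply: pf_le (F4 0 k); rewrite -ltnS.
apply: eq_pf pS _ => w.
have := F1 0 w 1; rewrite scale1r add0r => <-.
rewrite (horner_coef_wide _ (F0 w)); apply: eq_bigr => k _.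
by rewrite expr1n mulr1.
Qed.

(** Expand f(x + s v + s w) in the direction w at the point x + s v. The term of order 0 is [F x v],
    the orders strictly between 0 and k vanish by hypothesis, and the order k contributes its value
    at s = 0 to the coefficient of s ^ k. *)
Lemma hasse_additive W (f : W -> K) (F : W -> W -> {poly K}) N k x v w :
    (forall x v s, (F x v).[s] = f (x + s *: v)) ->
    (forall x v, (size (F x v) <= N)%N) ->
    (forall v j, polyf (fun x => (F x v)`_j)) -> (0 < k)%N ->
    (forall j, (0 < j < k)%N -> forall s, (F (x + s *: v) w)`_j = 0) ->
  (F x (v + w))`_k = (F x v)`_k + (F x w)`_k.
Proof.
move=> F1 F2 F3 k_gt0 F0.
have /choice[H HP] j : exists H : {poly K},
    forall s, H.[s] = (F (x + s *: v) w)`_j.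
  by have [n /hasse_expansion[H [H1 _ _ _]]] := F3 w j; exists (H x v).
have FH0 y u : (F y u)`_0 = f y.
  by rewrite -horner_coef0 F1 scale0r addr0.
have -> : F x (v + w) = F x v + \sum_(1 <= j < N) 'X^j * H j.
  apply: poly_ext => // s; rewrite hornerD horner_sum !F1 scalerDr addrA.
  have -> : f (x + s *: v + s *: w) = (F (x + s *: v) w).[s] by rewrite F1.
  rewrite (horner_coef_wide _ (F2 _ _)).
  have [N0|N_gt0] := posnP N.
    have -> : f (x + s *: v) = 0.
      by rewrite -(FH0 _ w) nth_default // (leq_trans (F2 _ _)) // N0.
    by rewrite big_geq ?N0 // big_ord0 addr0.
  rewrite -(big_mkord xpredT (fun i => (F (x + s *: v) w)`_i * s ^+ i)).
  rewrite big_ltn // FH0 mulr1; congr (_ + _); apply: eq_bigr => j _.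
  by rewrite hornerM hornerXn HP mulrC.
rewrite coefD; congr (_ + _); rewrite coef_sum.
have HX j : (0 < j)%N -> ('X^j * H j)`_k = if j == k then (F x w)`_k else 0.
  move=> j_gt0; rewrite coefXnM; case: (ltngtP k j) => // [ltjk|->].
    suff -> : H j = 0 by rewrite coef0.
    by apply: poly_ext => // s; rewrite HP F0 ?j_gt0 // horner0.
  by rewrite subnn -horner_coef0 HP scale0r addr0.
have [ltkN|leNk] := ltnP k N; last first.
  rewrite [RHS]nth_default; last exact: leq_trans leNk.
  rewrite big_nat big1 // => j /andP[j_gt0 ltjN]; rewrite HX //.
  by rewrite ltn_eqF // (leq_trans ltjN).
rewrite (bigD1_seq k) ?mem_index_iota ?k_gt0 ?iota_uniq //= HX // eqxx.
rewrite big_seq_cond big1 ?addr0 // => j /andP[].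
by rewrite mem_index_iota => /andP[j_gt0 _] /negPf ne_jk; rewrite HX // ne_jk.
Qed.

(* Finite differences: a polynomial of degree less than the number of
   directions is determined by its values on proper partial sums. *)
Lemma pf_difference W n (f : W -> K) (I : Type) (E : I -> W) (s : seq I) x :
    pf n f -> (n < size s)%N ->
    (forall r, (size r < size s)%N -> f (x + \sum_(i <- r) E i) = 0) ->
  f (x + \sum_(i <- s) E i) = 0.
Proof.
elim: s n f x => [//|i s IHs] n f x pff ltns f0.
case: n => [|n] in pff ltns *.
  by rewrite (pf0 pff _ (x + \sum_(i <- [::]) E i)); exact: f0.
(* Subtracting f removes the Hasse coefficient of index 0, and those of index at least 1 have
   smaller degree in w. *)
have pD : pf n (fun w => f (E i + w) + -1 * f w).
  have [F [F1 F2 F3 F4]] := hasse_expansion pff.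
  have pS : pf n (fun w => \sum_(1 <= k < n.+2) (F w (E i))`_k).
    rewrite [X in pf n X](_ : _ = fun w => \sum_(0 <= k < n.+1)
      (F w (E i))`_k.+1); last by apply/funext => w; rewrite big_add1.
    apply: pf_sum => k _; apply: pf_le (F3 _ _).
    by rewrite subSS leq_subr.
  apply: eq_pf pS _ => w; rewrite mulN1r addrC.
  have F10 : f w = (F w (E i))`_0.
    by rewrite -[RHS]horner_coef0 F1 scale0r addr0.
  have := F1 w (E i) 1; rewrite scale1r [E i + w]addrC => <-.
  rewrite (horner_coef_wide _ (F2 w (E i))).
  under [in RHS]eq_bigr do rewrite expr1n mulr1.
  by rewrite -(big_mkord xpredT) [in RHS]big_nat_recl // -F10 addKr big_add1.
have E1 r : E i + (x + \sum_(j <- r) E j) = x + \sum_(j <- i :: r) E j.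
  by rewrite big_cons addrCA.
have /(_ ltns) := IHs _ _ x pD.
rewrite E1 (f0 s) // mulr0 addr0; apply=> r ltrs.
rewrite E1 !f0 ?mulr0 ?addr0 //=; exact: leq_trans ltrs _.
Qed.

End PolynomialFunctions.

(** * Hilbert basis theorem *)

Lemma dep_choice I (T : I -> Type) (Q : forall i, T i -> Prop) :
  (forall i, exists x, Q i x) -> exists f : forall i, T i, forall i, Q i (f i).
Proof.
by move=> H; exists (fun i => sval (cid (H i))) => i; exact: svalP (cid (H i)).
Qed.

Lemma infinitely_often_subseq (Q : nat -> Prop) :
    (forall N, exists i, (N <= i)%N /\ Q i) ->
  exists s : nat -> nat,
    (forall i j, (i < j)%N -> (s i < s j)%N) /\ (forall i, Q (s i)).
Proof.
move=> /choice[g gP]; pose s i := iter i (fun m => g m.+1) (g 0%N).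
have sS i : (s i < s i.+1)%N by have [] := gP (s i).+1.
exists s; split=> [i j|[|i]]; last 2 first.
- by have [] := gP 0%N.
- by have [] := gP (s i).+1.
elim: j => // j IHj; rewrite ltnS leq_eqVlt => /predU1P[-> //|/IHj].
by move/ltn_trans; apply.
Qed.

(** Positions whose value is minimal among all later ones occur arbitrarily far out: beyond N,
    descend by strong induction on [u N]. *)
Lemma nondecreasing_subseq (u : nat -> nat) :
  exists s : nat -> nat,
    forall i j, (i < j)%N -> (s i < s j)%N /\ (u (s i) <= u (s j))%N.
Proof.
pose Q i := forall j, (i <= j)%N -> (u i <= u j)%N.
have [|s [sS sQ]] := @infinitely_often_subseq Q.
  move=> N; have [m] : exists m, m = u N by exists (u N).
  elim/ltn_ind: m N => m IHm N mE.
  have [NQ|] := pselect (Q N); first by exists N.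
  move=> /existsNP[j /not_implyP[leNj /negP]].
  rewrite -ltnNge -mE => ltj; have [i [leji Qi]] := IHm _ ltj _ erefl.
  by exists i; split => //; apply: leq_trans leji.
by exists s => i j ltij; split; [exact: sS|apply: sQ; exact/ltnW/sS].
Qed.

Module HilbertBasis.
Import mpoly.

(** Successive subsequences make one more coordinate nondecreasing each time. *)
Lemma dickson n (u : nat -> 'X_{1..n}) :
  exists i j, (i < j)%N /\ (u i <= u j)%MM.
Proof.
suff H k : exists s : nat -> nat, forall i j, (i < j)%N -> (s i < s j)%N /\
    forall a : 'I_n, (a < k)%N -> (u (s i) a <= u (s j) a)%N.
  have [s /(_ 0%N 1%N isT)[lt01 le01]] := H n.
  by exists (s 0%N), (s 1%N); split => //; apply/mnm_lepP => a; exact: le01.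
elim: k => [|k [s sP]]; first by exists id.
have [ltkn|lenk] := ltnP k n; last first.
  exists s => i j /sP[? le_ij]; split => // a _; apply: le_ij.
  exact: leq_trans lenk.
have [t tP] := nondecreasing_subseq (fun i => u (s i) (Ordinal ltkn)).
exists (s \o t) => i j /tP[/sP[ltst le_a] le_k]; split => // a.
rewrite ltnS leq_eqVlt => /predU1P[ak|/le_a //].
by have -> : a = Ordinal ltkn by apply: val_inj.
Qed.

(** The ideals [I i] of the polynomials vanishing at all [v j], j >= i, increase strictly. Pick
    [g i] in [I i.+1] outside [I i] with minimal leading monomial. By Dickson's lemma the leading
    monomial of some [g i] divides that of a later [g j]; cancelling it leaves an element of
    [I j.+1] outside [I j] with a smaller leading monomial. *)
Lemma no_bad_evaluations (K : fieldType) n (h : nat -> {mpoly K[n]})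
    (v : nat -> 'I_n -> K) :
    (forall i, (h i).@[v i] != 0) ->
  ~ (forall i j, (i < j)%N -> (h i).@[v j] = 0).
Proof.
move=> h1 h0.
pose I i (q : {mpoly K[n]}) := forall j, (i <= j)%N -> q.@[v j] = 0.
have IS i q : I i q -> I i.+1 q by move=> Iq j /ltnW; exact: Iq.
have I_le i j q : (i <= j)%N -> I i q -> I j q.
  by move=> leij Iq a leja; apply: Iq; apply: leq_trans leja.
have /choice[g gP] i : exists g, [/\ I i.+1 g, ~ I i g &
    forall q, I i.+1 q -> ~ I i q -> (mlead g <= mlead q)%O].
  apply: contrapT => noq.
  suff H q : I i.+1 q -> ~ ~ I i q.
    apply: (H (h i)) => [j ltij|Ihi]; first exact: h0.
    by have := h1 i; rewrite (Ihi i) ?eqxx.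
  elim/mleadrect: q => q IHq Iq Iq'; apply: noq; exists q; split => // r Ir Ir'.
  by rewrite leNgt; apply/negP => /IHq; apply.
have [i [j [ltij le_lead]]] := dickson (fun i => mlead (g i)).
have [Igi Igi' _] := gP i; have [Igj Igj' gjmin] := gP j.
have gi0 : g i != 0 by apply/eqP => E; apply: Igi' => a _; rewrite E meval0.
have gj0 : g j != 0 by apply/eqP => E; apply: Igj' => a _; rewrite E meval0.
pose m := (mlead (g j) - mlead (g i))%MM.
pose c := mleadc (g j) / mleadc (g i).
pose q := g j - c *: ('X_[m] * g i).
have c0 : c != 0 by rewrite mulf_neq0 ?invr_neq0 ?mleadc_eq0.
have X0 : 'X_[K, m] != 0 by rewrite -mleadc_eq0 mleadXm mcoeffX eqxx oner_eq0.
have leadE : mlead (c *: ('X_[m] * g i)) = mlead (g j).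
  by rewrite mleadZ // mleadM // mleadXm addmC addmBA // addmC addmK.
have Igi_j : I j (c *: ('X_[m] * g i)).
  by move=> a leja; rewrite mevalZ mevalM (I_le _ _ _ ltij Igi) // !mulr0.
have Iq : I j.+1 q.
  by move=> a ltja; rewrite mevalB (Igj a) // (IS _ _ Igi_j) // subr0.
have Iq' : ~ I j q.
  move=> Iq'; apply: Igj' => a leja.
  by have := Iq' a leja; rewrite mevalB Igi_j // subr0.
have := gjmin _ Iq Iq'; rewrite leNgt => /negP; apply.
have q0 : q != 0 by apply/eqP => E; apply: Iq' => a _; rewrite E meval0.
rewrite lt_neqAle; apply/andP; split; last first.
  by apply: le_trans (mleadB_le _ _) _; rewrite leadE joinxx.
apply: contraNneq q0 => leadq; rewrite -mleadc_eq0 leadq.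
rewrite mcoeffB mcoeffZ -[mlead (g j)]leadE mleadZ // mleadM // mleadcM.
rewrite mleadXm mcoeffX eqxx mul1r /c mulfVK ?mleadc_eq0 //.
by rewrite -{1}[mlead (g j)]leadE mleadZ // mleadM // mleadXm subrr.
Qed.

Lemma polyf_meval (K : fieldType) N (f : 'rV[K]_N -> K) : polyf f ->
  exists q : {mpoly K[N]}, forall x : 'rV_N, f x = q.@[x 0].
Proof.
move=> [n]; elim=> {n f} [c|l|n f g _ [p pE] _ [q qE]
  |m n f g _ [p pE] _ [q qE]|//].
- by exists c%:MP => x; rewrite mevalC.
- exists (\sum_i (l (delta_mx 0 i) : K) *: 'X_i) => x.
  rewrite {1}[x]row_sum_delta !linear_sum; apply: eq_bigr => i _.
  by rewrite /= mevalZ mevalXU linearZ mulrC.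
- by exists (p + q) => x; rewrite mevalD pE qE.
- by exists (p * q) => x; rewrite mevalM pE qE.
Qed.

Lemma no_bad_points (K : fieldType) N (f : nat -> 'rV[K]_N -> K)
    (p : nat -> 'rV[K]_N) :
    (forall i, polyf (f i)) -> (forall i, f i (p i) != 0) ->
  ~ (forall i j, (i < j)%N -> f i (p j) = 0).
Proof.
move=> pf f1 f0; have /choice[q qE] i := polyf_meval (pf i).
apply: (@no_bad_evaluations _ _ q (fun i => p i 0)) => [i|i j ltij].
  by rewrite -qE.
by rewrite -qE f0.
Qed.

End HilbertBasis.

(** * Spans of sets of row vectors *)

Section RowSpans.
Variables (K : fieldType) (N : nat).

(** Rows of A outside the current span are added one by one; this stops because N + 1 rows cannot be
    free. *)
Lemma row_span (A : 'rV[K]_N -> Prop) :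
  exists k (M : 'M[K]_(k, N)),
    [/\ row_free M, forall i, A (row i M) & forall v, A v -> (v <= M)%MS].
Proof.
suff H j : (exists M : 'M[K]_(j, N), row_free M /\ forall i, A (row i M)) \/
  exists k (M : 'M[K]_(k, N)),
    [/\ row_free M, forall i, A (row i M) & forall v, A v -> (v <= M)%MS].
  have [[M [/eqP rM _]]|//] := H N.+1.
  by have := rank_leq_col M; rewrite rM ltnn.
elim: j => [|j [[M [fM AM]]|]]; last by right.
  left; exists 0; split; last by case.
  by rewrite -row_leq_rank.
have [[v [Av Mv]]|noV] := pselect (exists v, A v /\ ~ (v <= M)%MS); last first.
  right; exists j, M; split => // v Av; apply: contrapT => Mv.
  by apply: noV; exists v.
have AM' (i : 'I_(1 + j)) : A (row i (col_mx v M)).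
  case: (split_ordP i) => i' ->; last by rewrite rowKd.
  by rewrite rowKu [i']ord1 row_id.
left; exists (col_mx v M); split; last exact: AM'.
rewrite -row_leq_rank; suff : (\rank M < \rank (v + M))%N.
  by rewrite addsmxE (eqP fM).
rewrite ltn_neqAle mxrankS ?addsmxSr // andbT; apply/negP => rE.
apply: Mv; apply: submx_trans (addsmxSl v M) _.
by have [_ <-] := mxrank_leqif_sup (addsmxSr v M).
Qed.

Lemma row_subspace (A : 'rV[K]_N -> Prop) :
    A 0 -> (forall a u v, A u -> A v -> A (a *: u + v)) ->
  exists M : 'M[K]_N, forall v, A v <-> (v <= M)%MS.
Proof.
move=> A0 AD; have [k [M [_ AM MA]]] := row_span A.
exists <<M>>%MS => v; rewrite genmxE; split=> [/MA //|/submxP[u ->]].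
rewrite mulmx_sum_row; elim/big_rec: _ => [//|i w _ Aw].
exact: AD.
Qed.

(** If A did not span, the cokernel of a maximal free family would have a nonzero column, and this
    column is annihilated by all of A. *)
Lemma spanning_rows (A : 'rV[K]_N -> Prop) :
    (forall c : 'cV[K]_N, (forall v, A v -> v *m c = 0) -> c = 0) ->
  exists2 M : 'M[K]_N, M \in unitmx & forall i, A (row i M).
Proof.
move=> A0; have [k [M [fM AM MA]]] := row_span A.
have kN : k = N.
  apply/eqP; rewrite eqn_leq -{1}(eqP fM) rank_leq_col /=.
  rewrite leqNgt; apply/negP => ltkN.
  have : cokermx M = 0.
    apply/matrixP => i j; suff /colP/(_ i) : col j (cokermx M) = 0.
      by rewrite !mxE.
    apply: A0 => v /MA; rewrite submxE => /eqP vM; apply/colP => a.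
    rewrite [LHS]mxE [RHS]mxE.
    have /matrixP/(_ a j) := vM.
    rewrite [X in X = _]mxE [X in _ = X]mxE => vMa; rewrite -[RHS]vMa.
    by apply: eq_bigr => b _; rewrite [col _ _ _ _]mxE.
  move=> /(congr1 mxrank); rewrite mxrank_coker mxrank0 => /eqP.
  by rewrite subn_eq0 (eqP fM) leqNgt ltkN.
subst k; exists M => //; by rewrite -row_free_unit.
Qed.

End RowSpans.

(** * Polynomial functors *)

(* P(K^n) is the space of row vectors of length [pdim P n], on which P(A), for
   A an n x m matrix, acts on the right. *)
Record pfunctor (K : fieldType) := PFunctor {
  pdim : nat -> nat;
  pact : forall n m, 'M[K]_(n, m) -> 'M[K]_(pdim n, pdim m);
  pact1 : forall n, pact (1%:M : 'M[K]_n) = 1%:M;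
  pactM : forall n m p (A : 'M[K]_(n, m)) (B : 'M[K]_(m, p)),
    pact (A *m B) = pact A *m pact B }.
Arguments pact {K} P {n m} A : rename.
Arguments pactM {K} P {n m p} A B : rename.

Record witness (K : fieldType) (P : pfunctor K) := Witness {
  wdim : nat;
  wfun : 'rV[K]_(pdim P wdim) -> K;
  wpt : 'rV[K]_(pdim P wdim) }.
Arguments wfun {K P} w x.

Section Functors.
Variable K : fieldType.
Implicit Types P : pfunctor K.

Definition degree_le D P :=
  forall n m i j, pf D (fun A : 'M[K]_(n, m) => pact P A i j).

(* A bad sequence is a certificate that P is not Noetherian: the closed subsets
   generated by its tails form a strictly descending chain. *)
Definition bad P (S : nat -> witness P) :=
  [/\ forall i, polyf (wfun (S i)), forall i, wfun (S i) (wpt (S i)) != 0 &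
      forall i j, (i < j)%N -> forall A : 'M[K]_(wdim (S j), wdim (S i)),
        wfun (S i) (wpt (S j) *m pact P A) = 0].

Definition noetherian P := forall S : nat -> witness P, ~ bad S.

Definition subfunctor P (R : forall n, 'M[K]_(pdim P n)) :=
  forall n m (A : 'M[K]_(n, m)), (R n *m pact P A <= R m)%MS.

Lemma pf_mulmx (W : lmodType K) D a b c d (M : W -> 'M[K]_(b, c))
    (A : 'M[K]_(a, b)) (B : 'M[K]_(c, d)) :
    (forall i j, pf D (fun w => M w i j)) ->
  forall i j, pf D (fun w => (A *m M w *m B) i j).
Proof.
move=> pM i j.
have pS : pf D (fun w => \sum_l B l j * (\sum_h A i h * M w h l)).
  by apply: pf_sum => l _; apply: pf_scale; apply: pf_sum => h _;
    apply: pf_scale.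
apply: eq_pf pS _ => w; rewrite mxE; apply: eq_bigr => l _.
by rewrite mulrC mxE.
Qed.

(** * Quotient by a subfunctor *)

Section Quotient.
Variables (P : pfunctor K) (R : forall n, 'M[K]_(pdim P n)).
Hypothesis Rsub : subfunctor R.

Definition quot_dim n := \rank (cokermx (R n)).
(** A column basis of the cokernel gives coordinates modulo R. The section [qsec] is merely linear
    and need not commute with the action, hence the corrections by R below. *)
Definition qproj n : 'M[K]_(pdim P n, quot_dim n) :=
  locked (col_base (cokermx (R n))).
Definition qsec n : 'M[K]_(quot_dim n, pdim P n) := locked (pinvmx (qproj n)).

Lemma qsecK n : qsec n *m qproj n = 1%:M.
Proof. by rewrite /qsec -lock mulVpmx // /qproj -lock col_base_full. Qed.

Lemma qproj_eq0 n k (x : 'M_(k, pdim P n)) :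
  (x *m qproj n == 0) = (x <= R n)%MS.
Proof.
rewrite submxE -[cokermx _]mulmx_base mulmxA /qproj -lock.
apply/eqP/eqP => [->|x0].
  by rewrite mul0mx.
by apply: (row_free_inj (row_base_free (cokermx (R n)))); rewrite x0 mul0mx.
Qed.

Lemma qproj_sub n k (x : 'M_(k, pdim P n)) :
  (x - x *m qproj n *m qsec n <= R n)%MS.
Proof.
by rewrite -qproj_eq0 mulmxBl -[X in _ - X]mulmxA qsecK mulmx1 subrr.
Qed.

Lemma qproj_act n m k (x : 'M_(k, pdim P n)) (A : 'M_(n, m)) :
  x *m qproj n *m qsec n *m pact P A *m qproj m = x *m pact P A *m qproj m.
Proof.
apply/eqP; rewrite eq_sym -subr_eq0 -!mulmxBl qproj_eq0.
by apply: submx_trans (Rsub A); apply: submxMr; exact: qproj_sub.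
Qed.

Definition quot_act n m (A : 'M[K]_(n, m)) := qsec n *m pact P A *m qproj m.

Lemma quot_act1 n : quot_act (1%:M : 'M_n) = 1%:M.
Proof. by rewrite /quot_act pact1 mulmx1 qsecK. Qed.

Lemma quot_actM n m p (A : 'M[K]_(n, m)) (B : 'M[K]_(m, p)) :
  quot_act (A *m B) = quot_act A *m quot_act B.
Proof. rewrite /quot_act pactM !mulmxA.
by rewrite qproj_act. Qed.

Definition quot := PFunctor quot_act1 quot_actM.

Lemma qproj_quot_act n m k (x : 'M_(k, pdim P n)) (A : 'M_(n, m)) :
  x *m qproj n *m pact quot A = x *m pact P A *m qproj m.
Proof. by rewrite /= /quot_act !mulmxA qproj_act. Qed.

Lemma quot_degree D : degree_le D P -> degree_le D quot.
Proof. by move=> degP n m i j; apply: pf_mulmx => a b; exact: degP. Qed.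

End Quotient.

(** * The shifted functor P(U + _) *)

Section Shift.
Variables (P : pfunctor K) (u : nat).

Definition diagu n m (A : 'M[K]_(n, m)) : 'M[K]_(u + n, u + m) :=
  block_mx 1%:M 0 0 A.
Definition prU n : 'M[K]_(u + n, u) := col_mx 1%:M 0.
Definition prV n : 'M[K]_(u + n, n) := col_mx 0 1%:M.
Definition inV n : 'M[K]_(n, u + n) := row_mx 0 1%:M.

Lemma diagu_prV n m (A : 'M_(n, m)) : diagu A *m prV m = prV n *m A.
Proof.
rewrite /diagu /prV mul_block_col mul_col_mx !mul0mx !mulmx0 !mulmx1 mul1mx.
by rewrite !add0r.
Qed.

Lemma inV_diagu n m (A : 'M_(n, m)) : inV n *m diagu A = A *m inV m.
Proof.
rewrite /diagu /inV mul_row_block mul_mx_row !mul0mx !mulmx0 mul1mx mulmx1.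
by rewrite addr0 add0r.
Qed.

Lemma inV_prV n : inV n *m prV n = 1%:M.
Proof. by rewrite /inV /prV mul_row_col mul0mx mulmx1 add0r. Qed.

Lemma inV_prU n : inV n *m prU n = 0.
Proof. by rewrite /inV /prU mul_row_col mul0mx mulmx0 addr0. Qed.

Definition shift_act n m (A : 'M[K]_(n, m)) := pact P (diagu A).

Lemma shift_act1 n : shift_act (1%:M : 'M_n) = 1%:M.
Proof. by rewrite /shift_act /diagu -scalar_mx_block pact1. Qed.

Lemma shift_actM n m p (A : 'M[K]_(n, m)) (B : 'M[K]_(m, p)) :
  shift_act (A *m B) = shift_act A *m shift_act B.
Proof.
rewrite /shift_act -pactM /diagu mulmx_block !mul0mx !mulmx0 mul1mx.
by rewrite !addr0 !add0r.
Qed.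

Definition shift := PFunctor shift_act1 shift_actM.

Lemma shift_degree D : degree_le D P -> degree_le D shift.
Proof.
move=> degP n m i j.
pose l (A : 'M[K]_(n, m)) : 'M[K]_(u + n, u + m) := block_mx 0 0 0 A.
have linl : linear l.
  by move=> a A B; rewrite /l scale_block_mx add_block_mx !scaler0 !addr0.
pose ll : {linear 'M[K]_(n, m) -> 'M[K]_(u + n, u + m)} :=
  HB.pack l (GRing.isLinear.Build K _ _ _ l linl).
apply: eq_pf (pf_affine ll (block_mx 1%:M 0 0 0) (degP _ _ i j)) _ => A.
by rewrite /= /l /shift_act /diagu add_block_mx !addr0 !add0r.
Qed.

(** This is the copy of R(V) in P(U + V) along the inclusion of V, not R(U + V). *)
Definition shift_sub (R : forall n, 'M[K]_(pdim P n)) n : 'M_(pdim shift n) :=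
  <<R n *m pact P (inV n)>>%MS.

Lemma shift_subfunctor R : subfunctor R -> subfunctor (shift_sub R).
Proof.
move=> Rsub n m A; rewrite /shift_sub genmxE (eqmxMr _ (genmxE _)).
rewrite -mulmxA -pactM inV_diagu pactM mulmxA.
exact: submxMr.
Qed.

End Shift.

(** * The homogeneous part of top degree *)

Hypothesis Kinf : many_elements K.

Lemma mx_poly_ext a b J (A B : nat -> 'M[K]_(a, b)) :
    (forall t, \sum_(j < J) t ^+ j *: A j = \sum_(j < J) t ^+ j *: B j) ->
  forall j, (j < J)%N -> A j = B j.
Proof.
move=> AB j ltj; apply/matrixP => i h.
suff /polyP/(_ j) : \poly_(j < J) A j i h = \poly_(j < J) B j i h.
  by rewrite !coef_poly ltj.
apply: poly_ext => // t; rewrite !horner_poly.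
have E (M : nat -> 'M[K]_(a, b)) :
    \sum_(j0 < J) M j0 i h * t ^+ j0 = (\sum_(j0 < J) t ^+ j0 *: M j0) i h.
  by rewrite summxE; apply: eq_bigr => j0 _; rewrite mxE mulrC.
by rewrite !E AB.
Qed.

Lemma mx_poly_top a b D (A : nat -> 'M[K]_(a, b)) x :
  (forall t, \sum_(j < D.+1) t ^+ j *: A j = t ^+ D *: x) -> A D = x.
Proof.
move=> Ax.
have := @mx_poly_ext _ _ D.+1 A (fun j => if j == D then x else 0) _ D
  (ltnSn D).
rewrite eqxx; apply=> t; rewrite Ax big_ord_recr /= eqxx big1 ?add0r // => j _.
by rewrite (ltn_eqF (ltn_ord j)) scaler0.
Qed.

(** The coefficient of index D has degree D - D = 0 in A, so that it does not depend on the base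
    point. *)
Lemma act_expansion D P n m : degree_le D P ->
  exists C : 'M[K]_(n, m) -> 'M[K]_(n, m) -> nat -> 'M[K]_(pdim P n, pdim P m),
    (forall A B t, pact P (A + t *: B) = \sum_(j < D.+1) t ^+ j *: C A B j) /\
    (forall A A' B, C A B D = C A' B D).
Proof.
move=> degP.
have /choice[F HF] (ij : 'I_(pdim P n) * 'I_(pdim P m)) :=
  hasse_expansion (degP n m ij.1 ij.2).
exists (fun A B k => \matrix_(i, j) (F (i, j) A B)`_k); split=> [A B t|A A' B].
  apply/matrixP => i j; have [F1 F2 _ _] := HF (i, j).
  rewrite -[LHS](F1 A B t) (horner_coef_wide _ (F2 _ _)) summxE.
  by apply: eq_bigr => k _; rewrite !mxE mulrC.
apply/matrixP => i j; rewrite !mxE; have [_ _ F3 _] := HF (i, j).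
by have := F3 B D; rewrite subnn => /pf0; apply.
Qed.

(** The rows of x have weight t ^ D under the scalar matrices: they lie in the homogeneous part of
    degree D. *)
Definition is_top D P n k (x : 'M[K]_(k, pdim P n)) :=
  forall t, x *m pact P (t%:M : 'M_n) = t ^+ D *: x.

(** [T n] is the coefficient of t ^ D in P(t id). The clauses follow by comparing coefficients,
    since scalars commute with all matrices. For the last one, the coefficient of t ^ D in P(id_U +
    t id_V) is the one in P(t id_V) by independence of the base point, and the latter factors
    through P(V): shifting does not enlarge the top part. *)
Lemma top_projection D P : degree_le D P ->
  exists T : forall n, 'M[K]_(pdim P n),
    [/\ forall n, is_top D (T n),
        forall n m (A : 'M_(n, m)), T n *m pact P A = pact P A *m T m,
        forall n k (x : 'M_(k, pdim P n)), is_top D x -> x *m T n = x,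
        forall n, exists C : nat -> 'M_(pdim P n), C D = T n /\
          forall t, pact P (t%:M : 'M_n) = \sum_(j < D.+1) t ^+ j *: C j &
        forall u n k (x : 'M_(k, pdim (shift P u) n)), is_top D x ->
          x = x *m pact P (prV u n) *m T n *m pact P (inV u n)].
Proof.
move=> degP.
have CE n := act_expansion n n degP.
pose C n := sval (cid (CE n)).
have C1 n A B t : pact P (A + t *: B) = \sum_(j < D.+1) t ^+ j *: C n A B j.
  by case: (svalP (cid (CE n))) => + _; apply.
have C2 n A A' B : C n A B D = C n A' B D.
  by case: (svalP (cid (CE n))) => _; apply.
have C0 n t : pact P (t%:M : 'M_n) = \sum_(j < D.+1) t ^+ j *: C n 0 1%:M j.
  by rewrite -C1 add0r scalemx1.
exists (fun n => C n 0 1%:M D); split=> [n t|n m A|n k x xtop|n|u n k x xtop].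
- apply: (@mx_poly_ext _ _ D.+1 (fun j => C n 0 1%:M j *m pact P t%:M)
    (fun j => t ^+ j *: C n 0 1%:M j) _ D) => // s.
  under eq_bigr do rewrite scalemxAl.
  rewrite -mulmx_suml -C0 -pactM -scalar_mxM C0.
  by apply: eq_bigr => j _; rewrite exprMn scalerA.
- apply: (@mx_poly_ext _ _ D.+1 (fun j => C n 0 1%:M j *m pact P A)
    (fun j => pact P A *m C m 0 1%:M j) _ D) => // s.
  under eq_bigr do rewrite scalemxAl.
  under [RHS]eq_bigr do rewrite scalemxAr.
  by rewrite -mulmx_suml -mulmx_sumr -!C0 -!pactM scalar_mxC.
- apply: (mx_poly_top (A := fun j => x *m C n 0 1%:M j)) => s.
  under eq_bigr do rewrite scalemxAr.
  by rewrite -mulmx_sumr -C0 xtop.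
- by exists (fun j => C n 0 1%:M j).
pose B : 'M[K]_(u + n) := block_mx 0 0 0 1%:M.
have CB : C _ (block_mx 1%:M 0 0 0) B D =
    pact P (prV u n) *m C n 0 1%:M D *m pact P (inV u n).
  rewrite (C2 _ _ 0); apply: (@mx_poly_ext _ _ D.+1 _ (fun j =>
    pact P (prV u n) *m C n 0 1%:M j *m pact P (inV u n)) _ D) => // t.
  rewrite -C1; under eq_bigr do rewrite scalemxAl scalemxAr.
  rewrite -mulmx_suml -mulmx_sumr -C0 -!pactM; congr (pact P _).
  rewrite add0r /B /prV /inV scale_block_mx !scaler0 scalemx1 mul_col_mx mul0mx.
  rewrite mul1mx mul_col_row !mul0mx mulmx0 mulmx1.
  by [].
rewrite -2!mulmxA (mulmxA (pact P (prV u n))) -CB.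
apply/esym.
apply: (mx_poly_top (A := fun j => x *m C _ (block_mx 1%:M 0 0 0) B j)) => s.
 under eq_bigr do rewrite scalemxAr.
rewrite -mulmx_sumr -C1 -xtop /= /shift_act /diagu; congr (_ *m pact P _).
by rewrite scale_block_mx !scaler0 scalemx1 add_block_mx !addr0 add0r.
Qed.

(* A polynomial functor of degree at most D is determined by its value on K^D:
   by finite differences, P(id) on K^n, n > D, is a linear combination of maps
   P(A) with A of rank less than n. *)
Lemma detection D P n (r : 'rV[K]_(pdim P n)) (c : 'cV[K]_(pdim P n)) :
    degree_le D P ->
    (forall (B : 'M_(n, D)) (C : 'M_(D, n)),
       r *m pact P B *m pact P C *m c = 0) ->
  r *m c = 0.
Proof.
move=> degP; have [m lenm] := ubnP n; elim: m => // m IHm in n r c lenm *.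
move=> rc; have [lenD|ltDn] := leqP n D.
  have := rc (pid_mx n) (pid_mx n).
  rewrite -(mulmxA r) -pactM mul_pid_mx minnn (minn_idPr lenD) pid_mx_1.
  by rewrite pact1 mulmx1.
have rc0 (A : 'M_n) : (\rank A < n)%N -> r *m pact P A *m c = 0.
  move=> ltA; rewrite -(mulmx_base A) pactM mulmxA -(mulmxA _ _ c).
  apply: IHm => [|B C]; first exact: leq_trans ltA _.
  have := rc (col_base A *m B) (C *m row_base A).
  by rewrite !pactM !mulmxA.
pose f (A : 'M[K]_n) := (r *m pact P A *m c) 0 0.
have pff : pf D f by apply: pf_mulmx => i j; exact: degP.
(* The identity is a sum of n > D diagonal matrix units, and a sum of fewer than n of them has rank
   less than n. *)
have := @pf_difference _ _ D f _ (fun i => delta_mx i i) (enum 'I_n) 0 pff.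
rewrite size_enum_ord => /(_ ltDn) f0.
apply/matrixP => i j; rewrite !ord1 [RHS]mxE -[r]mulmx1 -(pact1 P).
move: f0; rewrite add0r big_enum /= -mx1_sum_delta; apply=> s lts.
rewrite /f add0r rc0 ?mxE //; apply: leq_ltn_trans lts.
elim: s => [|a s IHs]; first by rewrite big_nil mxrank0.
rewrite big_cons (leq_trans (mxrank_add _ _)) // mxrank_delta.
by rewrite add1n.
Qed.

(** By [detection] the projections [T n] vanish for all n; then P(t A) = P(t id) P(A) has degree at
    most D in t. *)
Lemma degree_lower D P : degree_le D.+1 P ->
  (forall k (x : 'M_(k, pdim P D.+1)), is_top D.+1 x -> x = 0) -> degree_le D P.
Proof.
move=> degP top0; have [T [Ttop Tact _ TC _]] := top_projection degP.
have T0 n : T n = 0.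
  apply/matrixP => i j; rewrite [RHS]mxE.
  have : row i (T n) *m (delta_mx j 0 : 'cV_(pdim P n)) = 0.
    apply: (detection degP) => B C.
    by rewrite -row_mul Tact (top0 _ _ (Ttop _)) mulmx0 row0 !mul0mx.
  by rewrite -colE => /matrixP/(_ 0 0); rewrite mxE mxE mxE.
move=> n m i j; apply: pf_lower => // A.
have [C [CD CE]] := TC n.
exists (\poly_(k < D.+1) (C k *m pact P A) i j); first exact: size_poly.
move=> t; rewrite horner_poly -[t *: A]mul_scalar_mx pactM CE.
rewrite [in RHS]big_ord_recr /= CD T0 scaler0 addr0 mulmx_suml summxE.
by apply: eq_bigr => k _; rewrite -scalemxAl [RHS]mxE mulrC.
Qed.

Definition top_bound D P m :=
  forall k (x : 'M[K]_(k, pdim P D)), is_top D x -> (\rank x <= m)%N.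

Lemma shift_top_bound D P m u :
  degree_le D P -> top_bound D P m -> top_bound D (shift P u) m.
Proof.
move=> degP topP k x xtop.
have [T [_ Tact _ _ TS]] := top_projection degP.
rewrite (TS _ _ _ _ xtop) (leq_trans (mxrankM_maxl _ _)) //.
apply: leq_trans (mxrankM_maxl _ _) _; apply: topP => t.
rewrite -mulmxA -(pactM P (prV u D)) -diagu_prV pactM mulmxA.
by rewrite [X in X *m _](xtop t) scalemxAl.
Qed.

(** Composing a section with the projection T lifts top vectors of the quotient to top vectors of P.
    Together with those of [R D] they have rank at least [\rank x + \rank (R D)]. *)
Lemma quot_top_bound D P (R : forall n, 'M[K]_(pdim P n))
    (Rsub : subfunctor R) m :
    degree_le D P -> is_top D (R D) -> R D != 0 ->
    top_bound D P m.+1 -> top_bound D (quot Rsub) m.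
Proof.
move=> degP Rtop R0 topP k x xtop.
have [T [Ttop Tact Tid TC _]] := top_projection degP.
set y := x *m qsec R D *m T D.
have yx : y *m qproj R D = x.
  have [C [CD CE]] := TC D; rewrite /y -CD.
  apply: (mx_poly_top (A := fun j => x *m qsec R D *m C j *m qproj R D)) => t.
  under eq_bigr do rewrite scalemxAl scalemxAr.
  rewrite -mulmx_suml -mulmx_sumr -CE -xtop /= /quot_act !mulmxA.
  by [].
have ytop : is_top D (col_mx y (R D)).
  move=> t; rewrite mul_col_mx scale_col_mx Rtop; congr (col_mx _ _).
  by rewrite /y -mulmxA Ttop scalemxAr.
have := topP _ _ ytop; rewrite -addsmxE.
have Rpos : (0 < \rank (R D))%N by rewrite lt0n mxrank_eq0.
have : (\rank x + \rank (R D) <= \rank (y + R D))%N.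
  rewrite -(mxrank_mul_ker (y + R D)%MS (qproj R D)) leq_add //.
    by rewrite -{1}yx mxrankS // submxMr // addsmxSl.
  rewrite mxrankS // sub_capmx addsmxSr; apply/sub_kermxP/eqP.
  by rewrite qproj_eq0.
move=> h1 h2; have := leq_trans h1 h2; case: (\rank (R D)) Rpos => // q _.
by rewrite addnS ltnS; apply: leq_trans; exact: leq_addr.
Qed.

End Functors.

(** * Elimination in the top degree *)

(** In degree 0 the action does not depend on the matrix, so zero maps carry everything to P(K^0), a
    single finite-dimensional space. *)
Lemma noetherian_degree0 (K : fieldType) (P : pfunctor K) :
  degree_le 0 P -> noetherian P.
Proof.
move=> degP S [pS S1 S0].
have actE n m (A B : 'M_(n, m)) : pact P A = pact P B.
  by apply/matrixP => i j; exact: (pf0 (degP n m i j)).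
pose v i := wpt (S i) *m pact P (0 : 'M_(wdim (S i), 0)).
pose h i (x : 'rV_(pdim P 0)) :=
  wfun (S i) (x *m pact P (0 : 'M_(0, wdim (S i)))).
have hE i j : h i (v j) =
    wfun (S i) (wpt (S j) *m pact P (0 : 'M_(wdim (S j), wdim (S i)))).
  by rewrite /h /v -mulmxA -pactM mul0mx.
apply: (@HilbertBasis.no_bad_points _ _ h v) => [i|i|i j ltij].
- exact: (polyf_comp (mulmxr _) (pS i)).
- by rewrite hE (actE _ _ _ 1%:M) pact1 mulmx1.
- by rewrite hE S0.
Qed.

Lemma minimal_nat (Q : nat -> Prop) :
  (exists n, Q n) -> exists n, Q n /\ forall m, (m < n)%N -> ~ Q m.
Proof.
move=> [n]; elim/ltn_ind: n => n IHn Qn.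
have [[m [ltmn Qm]]|noQ] := pselect (exists m, (m < n)%N /\ Q m).
  exact: IHn Qm.
by exists n; split => // m ltmn Qm; apply: noQ; exists m.
Qed.

Section AdditivePower.
Variables (K : fieldType) (k : nat).
Hypotheses (k_gt0 : (0 < k)%N)
  (kD : forall a b : K, (a + b) ^+ k = a ^+ k + b ^+ k).

Lemma additive_exp_sum I (r : seq I) (F : I -> K) :
  (\sum_(i <- r) F i) ^+ k = \sum_(i <- r) F i ^+ k.
Proof.
elim: r => [|i r IHr]; first by rewrite !big_nil expr0n gtn_eqF.
by rewrite !big_cons kD IHr.
Qed.

(* As t |-> t ^ k is additive, f(c + sum_a r_a e_a) ^ k is a polynomial in the
   r_a ^ k, so that knowing the d r_a ^ k is enough after multiplication by a
   power of d. *)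
Lemma clear_denominators (W : lmodType K) n m (f : W -> K) (e : 'I_m -> W) :
    pf n f ->
  exists G : W -> K -> ('I_m -> K) -> K,
    (forall c d r, G c d (fun a => d * r a ^+ k) =
       d ^+ n * f (c + \sum_a r a *: e a) ^+ k) /\
    (forall (Y : lmodType K) (c : {linear Y -> W}) d (H : 'I_m -> Y -> K),
       polyf d -> (forall a, polyf (H a)) ->
       polyf (fun y => G (c y) (d y) (fun a => H a y))).
Proof.
elim=> {n f} [a|l|n f g _ [F [F1 F2]] _ [G [G1 G2]]
  |n1 n2 f g _ [F [F1 F2]] _ [G [G1 G2]]|n1 n2 f len _ [F [F1 F2]]].
- exists (fun _ _ _ => a ^+ k); split=> [c d r|Y c d H _ _].
    by rewrite mul1r.
  exact: polyf_cst.
- exists (fun c d h => d * (l c : K) ^+ k + \sum_a h a * (l (e a) : K) ^+ k).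
  split=> [c d r|Y c d H pd pH].
    rewrite linearD linear_sum kD additive_exp_sum mulrDr; congr (_ + _).
    rewrite mulr_sumr; apply: eq_bigr => a _.
    by rewrite linearZ exprMn mulrA.
  apply: polyf_add.
    apply: polyf_mul => //.
    exact: (polyf_exp k (polyf_comp c (polyf_lin l))).
  by apply: polyf_sum => a _; apply: polyf_mul => //; exact: polyf_cst.
- exists (fun c d h => F c d h + G c d h); split=> [c d r|Y c d H pd pH].
    by rewrite F1 G1 kD mulrDr.
  by apply: polyf_add; [exact: F2|exact: G2].
- exists (fun c d h => F c d h * G c d h); split=> [c d r|Y c d H pd pH].
    by rewrite F1 G1 exprD exprMn mulrACA.
  by apply: polyf_mul; [exact: F2|exact: G2].
(* The extra power of d compensates for the weaker degree bound. *)
- exists (fun c d h => d ^+ (n2 - n1) * F c d h); split=> [c d r|Y c d H pd pH].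
    by rewrite F1 mulrA -exprD subnK.
  by apply: polyf_mul; [exact: polyf_exp|exact: F2].
Qed.

End AdditivePower.

(** * Bad sequences modulo a minimal subfunctor of the top part *)

Section MainStep.
Variable K : fieldType.
Hypothesis Kinf : many_elements K.
Hypothesis Kperf : forall k, (0 < k)%N ->
  (forall a b : K, (a + b) ^+ k = a ^+ k + b ^+ k) ->
  forall c : K, exists s, s ^+ k = c.
Variables (D : nat) (P : pfunctor K) (R : forall n, 'M[K]_(pdim P n)).
Hypotheses (D_gt0 : (0 < D)%N) (degP : degree_le D P).
Hypotheses (Rsub : subfunctor R) (Rtop : forall n, is_top D (R n)).
Hypothesis Rirr : forall R' : forall n, 'M[K]_(pdim P n), subfunctor R' ->
  (forall n, (R' n <= R n)%MS) -> (exists n, R' n != 0) ->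
  forall n, (R n <= R' n)%MS.
Hypothesis quot_noeth : noetherian (quot Rsub).
Hypothesis shift_noeth :
  forall u, noetherian (quot (shift_subfunctor u Rsub)).

Definition orbit (S : nat -> witness P) n (x : 'rV_(pdim P n)) :=
  exists i (A : 'M_(wdim (S i), n)), x = wpt (S i) *m pact P A.

Lemma orbit_act S n m (x : 'rV_(pdim P n)) (A : 'M_(n, m)) :
  orbit S x -> orbit S (x *m pact P A).
Proof.
by move=> [i [B ->]]; exists i, (B *m A); rewrite pactM mulmxA.
Qed.

Lemma orbit_comp S s n (x : 'rV_(pdim P n)) : orbit (S \o s) x -> orbit S x.
Proof. by move=> [i [B ->]]; exists (s i), B. Qed.

Lemma bad_comp (S : nat -> witness P) s :
  (forall i j, (i < j)%N -> (s i < s j)%N) -> bad S -> bad (S \o s).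
Proof.
move=> sinc [S1 S2 S3]; split => [i|i|i j /sinc ltij A]; first exact: S1.
  exact: S2.
exact: S3.
Qed.

(* The ideal of the orbits of S, restricted to the functions on P / R. *)
Definition vanishing S n (g : 'rV_(quot_dim R n) -> K) :=
  forall x : 'rV_(pdim P n), orbit S x -> g (x *m qproj R n) = 0.

Definition vanishing_le S S' := forall n (g : 'rV_(quot_dim R n) -> K),
  polyf g -> vanishing S g -> vanishing S' g.

(* The witnesses of a strictly increasing chain of such ideals would form a bad
   sequence in P / R. *)
Lemma maximal_bad (S0 : nat -> witness P) : bad S0 ->
  exists S, bad S /\
    forall S', bad S' -> vanishing_le S S' -> vanishing_le S' S.
Proof.
move=> badS0; apply: contrapT => nomax.
pose T := {S : nat -> witness P | bad S}.
pose next (S S' : T) :=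
  vanishing_le (sval S) (sval S') /\ ~ vanishing_le (sval S') (sval S).
have nextE S : {S' | next S S'}.
  apply/cid; apply: contrapT => noS'; apply: nomax.
  exists (sval S); split; first exact: svalP S.
  move=> S' badS' le_SS'; apply: contrapT => nle_S'S; apply: noS'.
  by exists (exist _ S' badS').
have [s [_ sP]] := @dependent_choice T next nextE (exist _ S0 badS0).
have /choice[w wP] j : exists w : witness (quot Rsub),
    [/\ polyf (wfun w), @vanishing (sval (s j.+1)) (wdim w) (wfun w),
        wfun w (wpt w) != 0 &
        exists2 x : 'rV_(pdim P (wdim w)), orbit (sval (s j)) x &
          wpt w = x *m qproj R (wdim w)].
  have [_ /existsNP[n /existsNP[g]]] := sP j.
  move=> /not_implyP[pg /not_implyP[g0 /existsNP[x /not_implyP[xS /eqP gx]]]].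
  exists (@Witness _ (quot Rsub) n g (x *m qproj R n)); split => //.
  by exists x.
have le_s i j : (i <= j)%N -> vanishing_le (sval (s i)) (sval (s j)).
  elim: j => [|j IHj]; first by rewrite leqn0 => /eqP ->.
  rewrite leq_eqVlt => /predU1P[-> //|/IHj le_ij] n g pg /(le_ij _ _ pg).
  by have [+ _] := sP j; apply.
apply: (quot_noeth (S := w)); split => [i|i|i j ltij A].
- by have [] := wP i.
- by have [] := wP i.
have [pw w0 _ _] := wP i; have [_ _ _ [x xS ->]] := wP j.
rewrite qproj_quot_act; apply: (le_s _ _ ltij _ _ pw w0).
exact: orbit_act.
Qed.

(** Split x + r into the section of the class of x and a remainder [r'] in R. Freezing [r'] turns h
    into a function on P / R, to which the inclusion of ideals applies. *)
Lemma vanishing_translates S S' u (h : 'rV_(pdim P u) -> K) :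
    vanishing_le S' S -> polyf h ->
    (forall x r, orbit S' x -> (r <= R u)%MS -> h (x + r) = 0) ->
  forall x r, orbit S x -> (r <= R u)%MS -> h (x + r) = 0.
Proof.
move=> leS ph h0 x r xS rR.
pose r' := r + (x - x *m qproj R u *m qsec R u).
have r'R : (r' <= R u)%MS by rewrite addmx_sub // qproj_sub.
pose g y := h (r' + y *m qsec R u).
have pg : polyf g := polyf_affine (mulmxr (qsec R u)) r' ph.
suff /leS/(_ x xS) : vanishing S' g.
  by move=> /(_ pg); rewrite /g /r' -addrA subrK addrC.
move=> y yS'; rewrite /g.
have -> : r' + y *m qproj R u *m qsec R u =
    y + (r' - (y - y *m qproj R u *m qsec R u)).
  by rewrite addrCA opprB [y + _]addrC subrK.
apply: h0 => //; rewrite addmx_sub // -scaleN1r scalemx_sub //.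
exact: qproj_sub.
Qed.


Definition hasse_of N u (f : 'rV_(pdim P u) -> K)
    (F : 'rV_(pdim P u) -> 'rV_(pdim P u) -> {poly K}) :=
  [/\ forall x v s, (F x v).[s] = f (x + s *: v),
      forall x v, (size (F x v) <= N.+1)%N &
      forall v j, polyf (fun x => (F x v)`_j)].

Lemma hasse_coef0 N u (f : 'rV_(pdim P u) -> K) F x v :
  hasse_of N f F -> (F x v)`_0 = f x.
Proof. by move=> [F1 _ _]; rewrite -horner_coef0 F1 scale0r addr0. Qed.

(* Among all maximal bad sequences and all f vanishing on their orbits but not
   on their R-translates, take f of minimal degree. Its Hasse derivatives of
   order below k in the directions of R then vanish on all the translates, so
   that the k-th one is additive in the direction; k is 1 in characteristic 0
   and a power of p in characteristic p. *)
Lemma good_derivative (S0 : nat -> witness P) : bad S0 ->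
  exists (S : nat -> witness P) u (f : 'rV_(pdim P u) -> K) N F k
    (r0 : 'rV_(pdim P u)),
    [/\ [/\ bad S, polyf f, hasse_of N f F, (0 < k)%N & (r0 <= R u)%MS],
        forall x, orbit S x -> f x = 0,
        forall x v j, orbit S x -> (v <= R u)%MS -> (j < k)%N -> (F x v)`_j = 0,
        forall x v w, orbit S x -> (v <= R u)%MS -> (w <= R u)%MS ->
          (F x (v + w))`_k = (F x v)`_k + (F x w)`_k &
        forall i, exists A : 'M_(wdim (S i), u),
          (F (wpt (S i) *m pact P A) r0)`_k != 0].
Proof.
move=> /maximal_bad[S [badS Smax]].
pose Q n := exists (S1 : nat -> witness P) u (f : 'rV_(pdim P u) -> K),
  [/\ bad S1, vanishing_le S S1, pf n f, forall x, orbit S1 x -> f x = 0 &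
      exists x r, [/\ orbit S1 x, (r <= R u)%MS & f (x + r) != 0]].
have [|n [[S1 [u [f [badS1 leS1 pff f0 [x1 [r1 [x1S r1R fxr1]]]]]]] minn]] :=
    @minimal_nat Q.
  (* Some degree occurs: [wfun (S 0)] vanishes on the orbits of the tail [S1]. If it also vanished
     on their R-translates, maximality would make it vanish at [wpt (S 0)]. *)
  pose S1 := S \o succn.
  have badS1 : bad S1 by apply: bad_comp badS.
  have leS1 : vanishing_le S S1.
    by move=> n g _ g0 x /orbit_comp; exact: g0.
  have [[n pfS0] S0' S00] : [/\ polyf (wfun (S 0%N)),
      wfun (S 0%N) (wpt (S 0%N)) != 0 &
      forall x, orbit S1 x -> wfun (S 0%N) x = 0].
    by case: badS => SA SB SC; split=> // x [i [A ->]]; exact: SC.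
  exists n, S1, (wdim (S 0%N)), (wfun (S 0%N)); split => //.
  apply: contrapT => noxr; move/eqP: S0'; apply.
  rewrite -[wpt _]addr0 -[wpt _]mulmx1 -(pact1 P).
  apply: (vanishing_translates (S' := S1)); rewrite ?sub0mx //.
  - exact: Smax.
  - by exists n.
  - move=> x r xS rR; apply: contrapT => /eqP fxr; apply: noxr.
    by exists x, r.
  - by exists 0%N, 1%:M.
have [F [F1 F2 F3 F4]] := hasse_expansion pff.
have hF : hasse_of n f F.
  by split => // v j; exists (n - j)%N; exact: F3.
have F0 x v : (F x v)`_0 = f x by exact: hasse_coef0 hF.
(* k will be the least order of a nonzero derivative along R at a point of the orbits. *)
pose Q' k := exists x r, [/\ orbit S1 x, (r <= R u)%MS & (F x r)`_k != 0].
have [|k [[x2 [r0 [x2S r0R Fxr]]] mink]] := @minimal_nat Q'.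
  apply: contrapT => noQ; move/eqP: fxr1; apply.
  rewrite -[r1]scale1r -F1; suff -> : F x1 r1 = 0 by rewrite horner0.
  apply/polyP => k; rewrite coef0; apply: contrapT => /eqP Fk; apply: noQ.
  by exists k, x1, r1.
have k_gt0 : (0 < k)%N.
  by rewrite lt0n; apply: contraNneq Fxr => ->; rewrite F0 f0.
have Fj0 x v j : orbit S1 x -> (v <= R u)%MS -> (j < k)%N -> (F x v)`_j = 0.
  move=> xS vR /mink noQ; apply: contrapT => /eqP Fj; apply: noQ.
  by exists x, v.
have n_gt0 : (0 < n)%N.
  rewrite lt0n; apply: contraNneq Fxr => n0; rewrite nth_default //.
  by rewrite (leq_trans (F2 _ _)) // n0.
have lt_n j : (0 < j)%N -> (n - j < n)%N.
  by move=> j_gt0; rewrite ltn_subrL j_gt0.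
pose h x := (F x r0)`_k.
have ph : polyf h by exists (n - k)%N; exact: F3.
(* Otherwise h vanishes on the orbits of a tail. Its degree is below n, so by minimality it vanishes
   on their R-translates too, and by maximality on those for [S1], contradicting the choice of
   [x2]. *)
have hS1 M : exists i, (M <= i)%N /\
    exists A : 'M_(wdim (S1 i), u), h (wpt (S1 i) *m pact P A) != 0.
  apply: contrapT => noi; pose S2 := S1 \o addn M.
  have badS2 : bad S2.
    by apply: bad_comp badS1 => i j; rewrite ltn_add2l.
  have leS2 : vanishing_le S S2.
    by move=> m g pg /(leS1 _ _ pg) g0 x /orbit_comp; exact: g0.
  have hS2 x : orbit S2 x -> h x = 0.
    move=> [i [A ->]]; apply: contrapT => /eqP hx; apply: noi.
    by exists (M + i)%N; rewrite leq_addr; split => //; exists A.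
  move/eqP: Fxr; apply; rewrite -[x2]addr0 -/(h _).
  apply: (@vanishing_translates S1 S2 u h) => //; last exact: sub0mx.
    move=> m g pg g0; apply: leS1 => //; exact: (Smax S2 badS2 leS2 m g pg g0).
  move=> x r xS rR; apply: contrapT => /eqP hxr.
  apply: (minn _ (lt_n _ k_gt0)).
  exists S2, u, h; split => //; first exact: F3.
  by exists x, r.
have [s [sinc sP]] := infinitely_often_subseq hS1.
exists (S1 \o s), u, f, n, F, k, r0; split => //.
- by split => //; [exact: bad_comp|exists n].
- by move=> x /orbit_comp; exact: f0.
- by move=> x v j /orbit_comp; exact: Fj0.
move=> x v w /orbit_comp xS vR wR.
apply: (hasse_additive Kinf F1 F2) => [v' j|//|j /andP[j_gt0 ltjk] t].
  by case: hF => _ _; apply.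
(* A nonzero derivative of order j < k at a translate would be a function of degree below n
   vanishing on the orbits but not on their translates. *)
apply: contrapT => /eqP Fj; apply: (minn _ (lt_n _ j_gt0)).
exists S1, u, (fun y => (F y w)`_j); split => // [y yS|].
  exact: Fj0.
by exists x, (t *: v); split => //; rewrite scalemx_sub.
Qed.

(* The vectors w with delta(P(A) w) = 0 for all A form a subfunctor of R. *)
Lemma irreducible_pairing u (delta : 'rV[K]_(pdim P u) -> K) k r0 n
    (w : 'rV_(pdim P n)) :
    (forall v v', (v <= R u)%MS -> (v' <= R u)%MS ->
       delta (v + v') = delta v + delta v') ->
    (forall a v, delta (a *: v) = a ^+ k * delta v) ->
    (r0 <= R u)%MS -> delta r0 != 0 -> (w <= R n)%MS ->
    (forall A : 'M_(n, u), delta (w *m pact P A) = 0) ->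
  w = 0.
Proof.
move=> deltaD deltaZ r0R r00 wR w0.
have delta0 : delta 0 = 0.
  have := deltaD 0 0 (sub0mx _ _) (sub0mx _ _); rewrite addr0 => /eqP.
  by rewrite -subr_eq0 opprD addNKr oppr_eq0 => /eqP.
pose ann m (v : 'rV_(pdim P m)) := (v <= R m)%MS /\
  forall A : 'M_(m, u), delta (v *m pact P A) = 0.
have RA m (v : 'rV_(pdim P m)) (A : 'M_(m, u)) :
    (v <= R m)%MS -> (v *m pact P A <= R u)%MS.
  by move=> vR; apply: submx_trans (Rsub A); exact: submxMr.
have ann0 m : ann m 0.
  by split=> [|A]; rewrite ?sub0mx ?mul0mx.
have annD m a (v v' : 'rV_(pdim P m)) :
    ann m v -> ann m v' -> ann m (a *: v + v').
  move=> [vR v0] [v'R v'0]; split=> [|A].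
    by rewrite addmx_sub // scalemx_sub.
  rewrite mulmxDl -scalemxAl deltaD ?scalemx_sub ?RA //.
  by rewrite deltaZ v0 v'0 mulr0 addr0.
have R'E m := cid (row_subspace (ann0 m) (annD m)).
pose R' m := sval (R'E m).
have R'P m v : ann m v <-> (v <= R' m)%MS := svalP (R'E m) v.
have R'sub : subfunctor R'.
  move=> m p A; apply/row_subP => i; rewrite row_mul.
  have [vR v0] : ann m (row i (R' m)) by apply/R'P; exact: row_sub.
  apply/R'P; split=> [|B]; first by apply: submx_trans (Rsub A); exact: submxMr.
  by rewrite -mulmxA -pactM.
have R'R m : (R' m <= R m)%MS.
  by apply/row_subP => i; have [] : ann m (row i (R' m)) by
    apply/R'P; exact: row_sub.
apply: contrapT => /eqP wn0.
have R'n0 : exists m, R' m != 0.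
  exists n; apply: contraNneq wn0 => R'n.
  by rewrite -submx0 -R'n; apply/R'P; split.
have /R'P[_ /(_ 1%:M)] : (r0 <= R' u)%MS.
  by apply: submx_trans r0R _; exact: Rirr.
by rewrite pact1 mulmx1 => r0_0; rewrite r0_0 eqxx in r00.
Qed.


(** * Elimination of the component in R *)

Section Elimination.
Variables (S : nat -> witness P) (u : nat) (f : 'rV[K]_(pdim P u) -> K).
Variables (N : nat) (F : 'rV[K]_(pdim P u) -> 'rV[K]_(pdim P u) -> {poly K}).
Variables (k : nat) (r0 : 'rV[K]_(pdim P u)).
Hypotheses (polyf_f : polyf f) (hF : hasse_of N f F).
Hypotheses (k_gt0 : (0 < k)%N) (r0R : (r0 <= R u)%MS).
Hypothesis Fj0 : forall x v j,
  orbit S x -> (v <= R u)%MS -> (j < k)%N -> (F x v)`_j = 0.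
Hypothesis FkD : forall x v w, orbit S x -> (v <= R u)%MS -> (w <= R u)%MS ->
  (F x (v + w))`_k = (F x v)`_k + (F x w)`_k.

Lemma FkZ x a v : (F x (a *: v))`_k = a ^+ k * (F x v)`_k.
Proof.
case: hF => F1 F2 _; suff -> : F x (a *: v) = F x v \Po (a *: 'X).
  rewrite comp_polyE coef_sum.
  under eq_bigr do rewrite coefZ exprZn coefZ coefXn.
  have [ltk|gek] := ltnP k (size (F x v)).
    rewrite (bigD1 (Ordinal ltk)) //= eqxx mulr1 big1 ?addr0 1?mulrC // => i.
    by rewrite -val_eqE /= eq_sym => /negPf ->; rewrite !mulr0.
  rewrite [in RHS]nth_default // mulr0 big1 // => i _.
  by rewrite gtn_eqF ?mulr0 // (leq_trans _ gek).
by apply: poly_ext => // t; rewrite horner_comp !F1 !hornerE scalerA mulrC.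
Qed.

Lemma Fk_sum x m (c : 'I_m -> K) (v : 'I_m -> 'rV_(pdim P u)) :
    orbit S x -> (forall a, (v a <= R u)%MS) ->
  (F x (\sum_a c a *: v a))`_k = \sum_a c a ^+ k * (F x (v a))`_k.
Proof.
move=> xS vR.
suff [] : ((\sum_a c a *: v a)%R <= R u)%MS /\
  (F x (\sum_a c a *: v a))`_k = \sum_a c a ^+ k * (F x (v a))`_k by [].
elim/big_rec2: _ => [|a y w _ [wR wE]].
  split; first exact: sub0mx.
  by have := FkZ x 0 0; rewrite scale0r expr0n gtn_eqF // mul0r.
have avR : (c a *: v a <= R u)%MS by exact: scalemx_sub.
by split; [rewrite addmx_sub|rewrite FkD // FkZ wE].
Qed.

Lemma R_top n m (w : 'M_(m, pdim P n)) : (w <= R n)%MS -> is_top D w.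
Proof.
by move=> /submxP[c ->] t; rewrite -mulmxA Rtop scalemxAr.
Qed.

Lemma R_pact0 n m (b : 'M_(m, pdim P n)) :
  (b <= R n)%MS -> b *m pact P (0 : 'M_(n, u)) = 0.
Proof.
move=> bR; have -> : (0 : 'M_(n, u)) = (0 : K)%:M *m (0 : 'M_(n, u)).
  by rewrite mul_scalar_mx scale0r.
by rewrite pactM mulmxA (R_top bR) expr0n gtn_eqF // scale0r mul0mx.
Qed.

(* Take for G c the coefficient of t ^ (D * k) in f evaluated at the image of c
   under the linear map (v, w) |-> v + t * phi w. *)
Lemma degree_coefficient n (phi : 'M_(n, u)) :
  exists2 G : 'rV_(pdim P (u + n)) -> K, polyf G &
    forall x (w : 'rV_(pdim P n)), orbit S x -> (w <= R n)%MS ->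
      G (x - w *m pact P (inV K u n)) =
      (F (x *m pact P (prU K u n)) (- (w *m pact P phi)))`_k.
Proof.
have [C [CE _]] := act_expansion (u + n) u degP.
pose B : 'M[K]_(u + n, u) := col_mx 0 phi.
pose c j : {linear 'rV_(pdim P (u + n)) -> 'rV_(pdim P u)} :=
  mulmxr (C (prU K u n) B j).
have cE (y : 'rV_(pdim P (u + n))) t :
    \sum_(j < D.+1) t ^+ j *: c j y = y *m pact P (prU K u n + t *: B).
  rewrite CE mulmx_sumr; apply: eq_bigr => j _.
  by rewrite /c /= scalemxAr.
have [G [G1 G2]] := pf_curve D.+1 c polyf_f.
exists (fun y => (G y)`_(D * k)) => [|x w xS wR]; first exact: G2.
set v := - (w *m pact P phi).
have vR : (v <= R u)%MS.
  by rewrite /v -mulNmx (submx_trans _ (Rsub phi)) // submxMr // eqmx_opp.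
case: (hF) => F1 F2 F3.
have /choice[L LP] j : exists L : {poly K},
    forall t, L.[t] = (F (x *m pact P (prU K u n + t *: B)) v)`_j.
  have [L [L1 _]] := pf_curve D.+1 c (F3 v j).
  by exists (L x) => t; rewrite L1 cE.
(* As w has weight D, its image is scaled by t ^ D, and the order j contributes a multiple of t ^ (D
   * j). Orders below k vanish on the orbits, so that only j = k, taken at t = 0, reaches the
   coefficient of t ^ (D * k). *)
have GE : G (x - w *m pact P (inV K u n)) =
    \sum_(k <= j < N.+1) 'X^(D * j) * L j.
  apply: poly_ext => // t; rewrite G1 cE mulmxBl -mulmxA -pactM.
  have -> : inV K u n *m (prU K u n + t *: B) = t%:M *m phi.
    rewrite mulmxDr inV_prU add0r -scalemxAr /inV /B mul_row_col mul0mx mul1mx.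
    by rewrite add0r mul_scalar_mx.
  rewrite pactM mulmxA (R_top wR) -scalemxAl -scalerN -/v -F1.
  set z := x *m _; have zS : orbit S z by exact: orbit_act.
  rewrite (horner_coef_wide _ (F2 _ _)) horner_sum.
  rewrite -(big_mkord xpredT (fun i => (F z v)`_i * (t ^+ D) ^+ i)).
  have [lekN|ltNk] := leqP k N.+1; last first.
    rewrite [RHS]big_geq 1?ltnW // big_nat big1 // => j /andP[_ ltj].
    by rewrite Fj0 ?mul0r // (ltn_trans ltj).
  rewrite (big_cat_nat (leq0n k) lekN) /= big_nat big1 ?add0r; last first.
    by move=> j /andP[_ ltj]; rewrite Fj0 ?mul0r.
  by apply: eq_bigr => j _; rewrite hornerM hornerXn LP exprM mulrC.
rewrite GE coef_sum.
have LX j : (k <= j)%N -> ('X^(D * j) * L j)`_(D * k) =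
    if j == k then (F (x *m pact P (prU K u n)) v)`_k else 0.
  move=> lekj; rewrite coefXnM ltn_mul2l D_gt0 /=.
  case: (ltngtP k j) lekj => // -> _.
  by rewrite subnn -horner_coef0 LP scale0r addr0.
have [lekN|ltNk] := leqP k N; last first.
  by rewrite big_geq // nth_default // (leq_trans (F2 _ _)).
rewrite big_ltn // LX // eqxx big_nat big1 ?addr0 // => j /andP[ltkj _].
by rewrite LX ?gtn_eqF // ltnW.
Qed.

(** Evaluate the k-th derivative, additive and homogeneous of degree k on R, at (a + b) r0 and
    divide by its value at r0. *)
Lemma exp_k_additive x : orbit S x -> (F x r0)`_k != 0 ->
  forall a b : K, (a + b) ^+ k = a ^+ k + b ^+ k.
Proof.
move=> xS Fx a b; apply: (mulIf Fx); rewrite mulrDl -!FkZ scalerDl FkD //;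
  exact: scalemx_sub.
Qed.

(** A column c annihilating all the rows has k-th roots [s a] of its entries, by perfectness. The
    vector with coordinates s along R then pairs to zero with every phi, so it is zero by
    irreducibility, and c = 0. *)
Lemma spanning_derivatives x n : orbit S x -> (F x r0)`_k != 0 ->
  exists phi : 'I_(\rank (R n)) -> 'M_(n, u),
    \matrix_(l, a) (F x (row a (row_base (R n)) *m pact P (phi l)))`_k
      \in unitmx.
Proof.
move=> xS Fx; set b := row_base (R n).
have bR a : (row a b <= R n)%MS.
  by rewrite (submx_trans (row_sub _ _)) // eq_row_base.
have bphiR a (phi : 'M_(n, u)) : (row a b *m pact P phi <= R u)%MS.
  by apply: submx_trans (Rsub phi); exact: submxMr.
pose V v := exists phi : 'M_(n, u),
  v = \row_a (F x (row a b *m pact P phi))`_k.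
have [c cV|M Munit MV] := @spanning_rows _ _ V; last first.
  have /choice[phi phiP] := MV; exists phi.
  rewrite (_ : (\matrix_(l, a) _) = M) //.
  by apply/row_matrixP => l; rewrite phiP; apply/rowP => a; rewrite !mxE.
have /choice[s sP] a := Kperf k_gt0 (exp_k_additive xS Fx) (c a 0).
have w0 : \sum_a s a *: row a b = 0.
  apply: (irreducible_pairing (u := u) (delta := fun v => (F x v)`_k) (k := k)
    _ _ r0R Fx).
  - by move=> v v'; exact: FkD.
  - by move=> a v; exact: FkZ.
  - by apply: summx_sub => a _; exact: scalemx_sub.
  move=> phi; rewrite mulmx_suml.
  under eq_bigr do rewrite -scalemxAl.
  rewrite Fk_sum //.
  have /matrixP/(_ 0 0) := cV _ (ex_intro _ phi erefl).
  rewrite [X in X = _]mxE [X in _ = X]mxE => E; rewrite -[RHS]E.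
  by apply: eq_bigr => a _; rewrite mxE sP mulrC.
apply/colP => a; rewrite [RHS]mxE -sP.
have : (\row_a s a) *m b = 0 *m b.
  rewrite mul0mx mulmx_sum_row -[RHS]w0; apply: eq_bigr => i _.
  by rewrite mxE.
move=> /(row_free_inj (row_base_free _))/rowP/(_ a); rewrite !mxE => ->.
by rewrite expr0n gtn_eqF.
Qed.

(* On the orbits, Cramer's rule expresses d r_a ^ k, for d a nonzero minor and
   r_a the coordinates along R, as a polynomial in the coordinates modulo R;
   substitute this in d ^ deg(g) g ^ k. *)
Lemma eliminate n (g : 'rV_(pdim P (u + n)) -> K) (y : 'rV_(pdim P (u + n))) :
    polyf g -> orbit S y -> (F (y *m pact P (prU K u n)) r0)`_k != 0 ->
  exists h : 'rV_(quot_dim (shift_sub u R) n) -> K,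
    [/\ polyf h,
        g y != 0 -> h (y *m qproj (shift_sub u R) n) != 0 &
        forall x, orbit S x -> g x = 0 ->
          h (x *m qproj (shift_sub u R) n) = 0].
Proof.
move=> [ng pg] yS Fy; set R' := shift_sub u R.
set yU := y *m _ in Fy; have yUS : orbit S yU by exact: orbit_act.
have kD := exp_k_additive yUS Fy.
have [phi Munit] := spanning_derivatives n yUS Fy.
set b := row_base (R n) in Munit.
have bR a : (row a b <= R n)%MS.
  by rewrite (submx_trans (row_sub _ _)) // eq_row_base.
have bphiR a l : (row a b *m pact P (phi l) <= R u)%MS.
  by apply: submx_trans (Rsub (phi l)); exact: submxMr.
have /choice[G GP] l : exists G : 'rV_(pdim P (u + n)) -> K, polyf G /\
    forall x (w : 'rV_(pdim P n)), orbit S x -> (w <= R n)%MS ->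
      G (x - w *m pact P (inV K u n)) =
      (F (x *m pact P (prU K u n)) (- (w *m pact P (phi l))))`_k.
  by have [G pG GE] := degree_coefficient (phi l); exists G.
pose M (x : 'rV_(pdim P (u + n))) := \matrix_(l, a)
  (F (x *m pact P (prU K u n)) (row a b *m pact P (phi l)))`_k.
have pM l a : polyf (fun x => M x l a).
  have [_ _ F3] := hF.
  apply: eq_polyf (polyf_comp (mulmxr (pact P (prU K u n))) (F3 _ k)) _ => x.
  by rewrite mxE.
pose e a := - (row a b *m pact P (inV K u n)).
have [H [H1 H2]] := clear_denominators k_gt0 kD e pg.
pose d x := \det (M x).
have pd : polyf d by exact: polyf_det.
pose t a x := \sum_l (\adj (M x)) a l * G l x.
have pt a : polyf (t a).
  apply: polyf_sum => l _; apply: polyf_mul; first exact: polyf_adj.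
  by have [] := GP l.
pose s : {linear 'rV_(quot_dim R' n) -> 'rV_(pdim P (u + n))} :=
  mulmxr (qsec R' n).
exists (fun x => H (s x) (d (s x)) (fun a => t a (s x))).
(* c represents x modulo the copy of R(V). The two differ only by an element killed by the
   projection to U, which is all that M sees. *)
have hE x : orbit S x -> exists2 c, c = s (x *m qproj R' n) &
    M c = M x /\ H c (d c) (fun a => t a c) = d x ^+ ng * g x ^+ k.
  move=> xS; exists (s (x *m qproj R' n)) => //; set c := s _.
  have xcR : (x - c <= b *m pact P (inV K u n))%MS.
    have := qproj_sub R' x; rewrite genmxE => xcR; apply: submx_trans xcR _.
    by apply: submxMr; rewrite eq_row_base.
  have [r rE] := submxP xcR.
  have cE : c = x - r *m b *m pact P (inV K u n).
    by rewrite -mulmxA -rE opprB addrC subrK.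
  have rbR : (r *m b <= R n)%MS.
    by rewrite (submx_trans (submxMl _ _)) // eq_row_base.
  have McE : M c = M x.
    apply/matrixP => l a; rewrite !mxE cE mulmxBl -(mulmxA (r *m b)).
    by rewrite -(pactM P (inV K u n)) inV_prU R_pact0 // subr0.
  split=> //.
  (* Cramer's rule: the values [G l c] are the matrix [M c] applied to the k-th powers of the
     coordinates of - r. *)
  have tE a : t a c = d c * (- r 0 a) ^+ k.
    rewrite /t /d -[RHS]mulr1; transitivity
      ((\adj (M c) *m M c *m \col_a (- r 0 a) ^+ k) a 0); last first.
      by rewrite mul_adj_mx mul_scalar_mx !mxE mulr1.
    rewrite -mulmxA mxE; apply: eq_bigr => l _; congr (_ * _).
    rewrite [in LHS]cE; have [_ ->//] := GP l; rewrite mxE McE.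
    rewrite (mulmx_sum_row r b) mulmx_suml -sumrN.
    under eq_bigr do rewrite -scalemxAl -scaleNr.
    rewrite Fk_sum //; last exact: orbit_act.
    by apply: eq_bigr => a' _; rewrite !mxE mulrC.
  rewrite (_ : (fun a => t a c) = fun a => d c * (- r 0 a) ^+ k); last first.
    by apply/funext.
  rewrite H1 /d McE; congr (_ * g _ ^+ _).
  have -> : \sum_a - r 0 a *: e a = x - c.
    rewrite rE mulmx_sum_row; apply: eq_bigr => a _.
    by rewrite /e scaleNr scalerN opprK row_mul.
  by rewrite addrC subrK.
split.
- apply: (H2 _ s (fun x => d (s x)) (fun a x => t a (s x))) => [|a].
    exact: polyf_comp pd.
  exact: polyf_comp (pt a).
- have [_ -> [McE ->]] := hE y yS; move=> gy.
  by rewrite mulf_neq0 // expf_neq0 // -unitfE -unitmxE.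
- move=> x xS gx; have [_ -> [McE ->]] := hE x xS.
  by rewrite gx expr0n gtn_eqF // mulr0.
Qed.

End Elimination.


(** The points [q i] of P(U + V) restrict to [wpt (S i)] on V and, on U, to a point where the chosen
    derivative is nonzero. Pulling [wfun (S i)] back along the projection to V and eliminating the
    component in R gives functions that, with the classes of the [q i], form a bad sequence in the
    quotient of the shift. *)
Theorem noetherian_step : noetherian P.
Proof.
move=> S0 /good_derivative[S [u [f [N [F [k [r0 [[badS pf hF k_gt0 r0R]
  f0 Fj0 FkD FA]]]]]]]].
have [A AP] := @dep_choice _ (fun i => 'M_(wdim (S i), u))
  (fun i A => (F (wpt (S i) *m pact P A) r0)`_k != 0) FA.
pose q i := wpt (S i) *m pact P (row_mx (A i) 1%:M).
have qS i : orbit S (q i) by exists i, (row_mx (A i) 1%:M).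
case: badS => S1 S2 S3.
pose R' := shift_sub u R.
pose Q i (h : 'rV_(quot_dim R' (wdim (S i))) -> K) :=
  [/\ polyf h, h (q i *m qproj R' (wdim (S i))) != 0 &
      forall x, orbit S x ->
        wfun (S i) (x *m pact P (prV K u (wdim (S i)))) = 0 ->
        h (x *m qproj R' (wdim (S i))) = 0].
have [i|h hP] := dep_choice (Q := Q).
  pose g (x : 'rV_(pdim P (u + wdim (S i)))) :=
    wfun (S i) (x *m pact P (prV K u (wdim (S i)))).
  have pg : polyf g := polyf_comp (mulmxr _) (S1 i).
  have qU : q i *m pact P (prU K u (wdim (S i))) = wpt (S i) *m pact P (A i).
    rewrite /q -mulmxA -pactM /prU mul_row_col mulmx1 mulmx0 addr0.
    by [].
  have [|h [ph h1 h2]] := eliminate pf hF k_gt0 r0R Fj0 FkD pg (qS i).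
    by rewrite qU.
  exists h; split => //; apply: h1.
  rewrite /g /q -mulmxA -pactM /prV mul_row_col mulmx0 mulmx1 add0r pact1.
  by rewrite mulmx1 S2.
pose w i : witness (quot (shift_subfunctor u Rsub)) :=
  @Witness _ (quot (shift_subfunctor u Rsub)) (wdim (S i)) (h i)
    (q i *m qproj R' (wdim (S i))).
apply: (shift_noeth (S := w)); split => [i|i|i j ltij B].
- by have [] := hP i.
- by have [] := hP i.
have [_ _ h0] := hP i; rewrite /w /= in B *.
have := qproj_quot_act (shift_subfunctor u Rsub) (q j) B => /= ->.
apply: h0; first exact: (orbit_act (diagu u B)).
rewrite /shift_act -mulmxA -pactM diagu_prV pactM mulmxA.
rewrite /q -(mulmxA (wpt _)) -pactM /prV mul_row_col mulmx0 mulmx1 add0r pact1.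
by rewrite mulmx1 S3.
Qed.

End MainStep.

(** * Induction on the degree and on the dimension of the top part *)

Section Induction.
Variable K : fieldType.
Hypothesis Kinf : many_elements K.

Lemma detection_sub D (P : pfunctor K) n k (R : 'M_(k, pdim P n))
    (r : 'rV_(pdim P n)) : degree_le D P ->
    (forall (B : 'M_(n, D)) (C : 'M_(D, n)),
       (r *m pact P B *m pact P C <= R)%MS) ->
  (r <= R)%MS.
Proof.
move=> degP rR; rewrite submxE; apply/eqP/rowP => j.
have : r *m col j (cokermx R) = 0.
  apply: (detection degP) => B C; have := rR B C; rewrite submxE => /eqP E.
  apply/matrixP => a b; rewrite [RHS]mxE.
  have /matrixP/(_ a j) := E; rewrite [X in X = _]mxE [X in _ = X]mxE => E'.
  by rewrite mxE -[RHS]E'; apply: eq_bigr => c _; rewrite [col _ _ _ _]mxE.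
move=> /matrixP/(_ 0 0); rewrite [X in X = _]mxE [X in _ = X]mxE => E.
rewrite mxE [RHS]mxE -[RHS]E; apply: eq_bigr => c _.
by rewrite [col _ _ _ _]mxE.
Qed.

(** Minimise the rank at K^D among nonzero top subfunctors. By detection, both vanishing and
    inclusion of subfunctors can be tested at K^D. *)
Lemma minimal_subfunctor D (P : pfunctor K) : degree_le D P ->
    ~ (forall k (x : 'M_(k, pdim P D)), is_top D x -> x = 0) ->
  exists R : forall n, 'M[K]_(pdim P n),
    [/\ subfunctor R, forall n, is_top D (R n), R D != 0 &
        forall R' : forall n, 'M[K]_(pdim P n), subfunctor R' ->
          (forall n, (R' n <= R n)%MS) -> (exists n, R' n != 0) ->
        forall n, (R n <= R' n)%MS].
Proof.
move=> degP /existsNP[k /existsNP[x /not_implyP[xtop /eqP x0]]].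
pose Q r := exists R : forall n, 'M[K]_(pdim P n),
  [/\ subfunctor R, forall n, is_top D (R n), R D != 0 & \rank (R D) = r].
have [|r [[R [Rsub Rtop R0 Rr]] minr]] := @minimal_nat Q.
  have [T [Ttop Tact Tid _ _]] := top_projection Kinf degP.
  exists (\rank (T D)), T; split => //.
    by move=> n m A; rewrite Tact submxMl.
  by apply: contraNneq x0 => T0; rewrite -(Tid _ _ _ xtop) T0 mulmx0.
exists R; split => // R' R'sub R'R [n R'n] m.
have R'top p : is_top D (R' p).
  by move=> t; have /submxP[c ->] := R'R p; rewrite -mulmxA Rtop scalemxAr.
have R'D : R' D != 0.
  apply: contraNneq R'n => R'D; rewrite -submx0; apply/row_subP => i.
  apply: (detection_sub degP) => B C.
  rewrite submx0 -row_mul; have := R'sub _ _ B; rewrite R'D submx0 => /eqP ->.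
  by rewrite row0 mul0mx.
have RR'D : (R D <= R' D)%MS.
  have [_ <-] := mxrank_leqif_sup (R'R D).
  rewrite eqn_leq (mxrankS (R'R D)) Rr leqNgt; apply/negP => ltr.
  by apply: (minr _ ltr); exists R'.
apply/row_subP => i; apply: (detection_sub degP) => B C.
apply: submx_trans (R'sub _ _ C); apply: submxMr.
apply: submx_trans RR'D; apply: submx_trans (Rsub _ _ B).
by apply: submxMr; exact: row_sub.
Qed.

Hypothesis Kperf : forall k, (0 < k)%N ->
  (forall a b : K, (a + b) ^+ k = a ^+ k + b ^+ k) ->
  forall c : K, exists s, s ^+ k = c.

(** The inner induction bounds only the top part at K^(D + 1): shifting enlarges P but keeps this
    bound, and dividing by R lowers it. *)
Theorem finite_degree_noetherian D (P : pfunctor K) :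
  degree_le D P -> noetherian P.
Proof.
elim: D P => [|D IHD] P degP; first exact: noetherian_degree0.
have : top_bound D.+1 P (pdim P D.+1) by move=> k x _; exact: rank_leq_col.
move: (pdim P D.+1) => m; elim: m => [|m IHm] in P degP *.
  move=> top0; apply: IHD; apply: degree_lower => // k x /top0.
  by rewrite leqn0 mxrank_eq0 => /eqP.
have [top0 _|ntop0 topm] :=
    pselect (forall k (x : 'M_(k, pdim P D.+1)), is_top D.+1 x -> x = 0).
  by apply: IHD; exact: degree_lower.
have [R [Rsub Rtop R0 Rirr]] := minimal_subfunctor degP ntop0.
apply: (@noetherian_step _ Kinf Kperf D.+1 P R) => //.
  by apply: IHm; [exact: quot_degree|exact: quot_top_bound].
move=> u; apply: IHm; first exact/quot_degree/shift_degree.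
apply: quot_top_bound => //; first exact: shift_degree; last first.
- exact: shift_top_bound.
(* The projection to V recovers R from its copy in the shift, so this copy is nonzero. *)
- apply: contraNneq R0 => /(congr1 mxrank); rewrite mxrank0 mxrank_gen.
  move=> /eqP; rewrite mxrank_eq0 => /eqP R0.
  by rewrite -[R _]mulmx1 -(pact1 P) -(inV_prV K u) pactM mulmxA R0 mul0mx.
move=> t; have /submxP[c ->] : (shift_sub u R D.+1 <=
    R D.+1 *m pact P (inV K u D.+1))%MS by rewrite genmxE.
rewrite -mulmxA scalemxAr; congr (_ *m _).
rewrite /= /shift_act -(mulmxA (R _)) -(pactM P (inV K u D.+1)) inV_diagu pactM.
by rewrite mulmxA Rtop scalemxAl.
Qed.

End Induction.

(** * Perfect closure *)

Local Open Scope quotient_scope.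

Section PerfectClosure.
Variables (K : fieldType) (p : nat).
Hypothesis pcharK : p \in [pchar K].

Local Notation frob m x := (x ^+ (p ^ m)).

Lemma frob0 m : frob m (0 : K) = 0.
Proof.
by rewrite expr0n expn_eq0 (gtn_eqF (prime_gt0 (pcharf_prime pcharK))).
Qed.

Lemma frobD m (x y : K) : frob m (x + y) = frob m x + frob m y.
Proof.
elim: m => // m IHm; rewrite expnSr !exprM IHm.
exact: (pFrobenius_autD_comm pcharK (mulrC _ _)).
Qed.

Lemma frobN m (x : K) : frob m (- x) = - frob m x.
Proof. by apply/eqP; rewrite -subr_eq0 opprK -frobD addNr frob0. Qed.

Lemma frob_inj m : injective (fun x : K => frob m x).
Proof.
move=> x y /= /eqP; rewrite -subr_eq0 -frobN -frobD expf_eq0 => /andP[_].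
by rewrite subr_eq0 => /eqP.
Qed.

Lemma frobA m n (x : K) : frob n (frob m x) = frob (m + n) x.
Proof. by rewrite -exprM expnD. Qed.

(* The pair (n, a) stands for the p ^ n-th root of a. *)
Definition root_eq (x y : nat * K) := frob y.1 x.2 == frob x.1 y.2.

Lemma root_eq_refl : reflexive root_eq.
Proof. by move=> x; rewrite /root_eq. Qed.

Lemma root_eq_sym : symmetric root_eq.
Proof. by move=> x y; rewrite /root_eq eq_sym. Qed.

Lemma root_eq_trans : transitive root_eq.
Proof.
move=> y x z /eqP xy /eqP yz; apply/eqP; apply: (@frob_inj y.1).
by rewrite frobA addnC -frobA xy frobA addnC -frobA yz !frobA addnC.
Qed.

Canonical root_equiv := EquivRel root_eq root_eq_refl root_eq_sym root_eq_trans.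
Definition perfection := {eq_quot root_equiv}%qT.

HB.instance Definition _ : EqQuotient _ root_eq perfection :=
  EqQuotient.on perfection.
HB.instance Definition _ := Choice.on perfection.

Implicit Types x y z : perfection.

Definition proot n a : perfection := \pi_perfection (n, a).

Lemma proot_eq n a m b : proot n a = proot m b <-> frob m a = frob n b.
Proof.
split=> [/eqmodP/eqP //|ab]; exact/eqmodP/eqP.
Qed.

Lemma proot_inj n : injective (proot n).
Proof. by move=> a b /proot_eq/frob_inj. Qed.

Lemma proot_raise n m a : proot n a = proot (n + m) (frob m a).
Proof. by apply/proot_eq; rewrite frobA addnC. Qed.

Lemma prootP x : exists n a, x = proot n a.
Proof.
by exists (repr x).1, (repr x).2; rewrite /proot -surjective_pairing reprK.
Qed.

Lemma common_level2 x y : exists n a b, x = proot n a /\ y = proot n b.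
Proof.
have [n [a ->]] := prootP x; have [m [b ->]] := prootP y.
exists (n + m)%N, (frob m a), (frob n b).
by rewrite -proot_raise addnC -proot_raise.
Qed.

Lemma common_level3 x y z :
  exists n a b c, [/\ x = proot n a, y = proot n b & z = proot n c].
Proof.
have [n [a [b [-> ->]]]] := common_level2 x y; have [m [c ->]] := prootP z.
exists (n + m)%N, (frob m a), (frob m b), (frob n c).
by rewrite -!proot_raise addnC -proot_raise.
Qed.

(** Both representatives are raised to the level [a.1 + b.1]. The result is independent of them once
    [op] commutes with Frobenius powers. *)
Definition lift2 (op : K -> K -> K) x y :=
  let a := repr x in let b := repr y in
  proot (a.1 + b.1) (op (frob b.1 a.2) (frob a.1 b.2)).
Definition lift1 (op : K -> K) x := proot (repr x).1 (op (repr x).2).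

Lemma repr_proot n a :
  frob n (repr (proot n a)).2 = frob (repr (proot n a)).1 a.
Proof. by apply/proot_eq; rewrite /proot -surjective_pairing reprK. Qed.

Lemma lift2E op : (forall m a b, frob m (op a b) = op (frob m a) (frob m b)) ->
  forall n a b, lift2 op (proot n a) (proot n b) = proot n (op a b).
Proof.
move=> opF n a b; apply/proot_eq; rewrite !opF.
set x := repr _; set y := repr _.
have xE : frob n x.2 = frob x.1 a by exact: repr_proot.
have yE : frob n y.2 = frob y.1 b by exact: repr_proot.
rewrite !frobA; congr op; last by rewrite addnC -frobA yE frobA addnC.
by rewrite addnC -frobA xE frobA.
Qed.

Lemma lift1E op : (forall m a, frob m (op a) = op (frob m a)) ->
  forall n a, lift1 op (proot n a) = proot n (op a).
Proof. by move=> opF n a; apply/proot_eq; rewrite !opF repr_proot. Qed.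

Definition padd := lift2 +%R.
Definition pmul := lift2 *%R.
Definition popp := lift1 -%R.
Definition pinv := lift1 GRing.inv.

Lemma paddE n a b : padd (proot n a) (proot n b) = proot n (a + b).
Proof. by rewrite /padd lift2E // => *; exact: frobD. Qed.
Lemma pmulE n a b : pmul (proot n a) (proot n b) = proot n (a * b).
Proof. by rewrite /pmul lift2E // => *; exact: exprMn. Qed.
Lemma poppE n a : popp (proot n a) = proot n (- a).
Proof. by rewrite /popp lift1E // => *; exact: frobN. Qed.
Lemma pinvE n a : pinv (proot n a) = proot n a^-1.
Proof. by rewrite /pinv lift1E // => *; exact: exprVn. Qed.
Lemma proot0 n : proot 0 0 = proot n 0.
Proof. by apply/proot_eq; rewrite !frob0. Qed.
Lemma proot1 n : proot 0 1 = proot n 1.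
Proof. by apply/proot_eq; rewrite !expr1n. Qed.

Fact paddA : associative padd.
Proof.
move=> x y z; have [n [a [b [c [-> -> ->]]]]] := common_level3 x y z.
by rewrite !paddE addrA.
Qed.
Fact paddC : commutative padd.
Proof.
move=> x y; have [n [a [b [-> ->]]]] := common_level2 x y.
by rewrite !paddE addrC.
Qed.
Fact padd0 : left_id (proot 0 0) padd.
Proof.
by move=> x; have [n [a ->]] := prootP x; rewrite (proot0 n) paddE add0r.
Qed.
Fact paddN : left_inverse (proot 0 0) popp padd.
Proof.
by move=> x; have [n [a ->]] := prootP x; rewrite (proot0 n) poppE paddE addNr.
Qed.
HB.instance Definition _ :=
  GRing.isZmodule.Build perfection paddA paddC padd0 paddN.

Fact pmulA : associative pmul.
Proof.
move=> x y z; have [n [a [b [c [-> -> ->]]]]] := common_level3 x y z.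
by rewrite !pmulE mulrA.
Qed.
Fact pmulC : commutative pmul.
Proof.
move=> x y; have [n [a [b [-> ->]]]] := common_level2 x y.
by rewrite !pmulE mulrC.
Qed.
Fact pmul1 : left_id (proot 0 1) pmul.
Proof.
by move=> x; have [n [a ->]] := prootP x; rewrite (proot1 n) pmulE mul1r.
Qed.
Fact pmulD : left_distributive pmul padd.
Proof.
move=> x y z; have [n [a [b [c [-> -> ->]]]]] := common_level3 x y z.
by rewrite paddE !pmulE paddE mulrDl.
Qed.
Fact pone_neq0 : proot 0 1 != proot 0 0.
Proof. by apply/eqP => /proot_inj/eqP; rewrite oner_eq0. Qed.
HB.instance Definition _ := GRing.Zmodule_isComNzRing.Build perfection
  pmulA pmulC pmul1 pmulD pone_neq0.

Fact pmulV x : x != 0 -> pinv x * x = 1.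
Proof.
have [n [a ->]] := prootP x; rewrite -[0]/(proot 0 0) (proot0 n) => a0.
rewrite -[1]/(proot 0 1) -[_ * _]/(pmul _ _) pinvE pmulE mulVf -?proot1 //.
by apply: contraNneq a0 => ->.
Qed.
Fact pinv0 : pinv 0 = 0.
Proof. by rewrite -[0]/(proot 0 0) pinvE invr0. Qed.
HB.instance Definition _ :=
  GRing.ComNzRing_isField.Build perfection pmulV pinv0.

Fact proot_additive : zmod_morphism (proot 0).
Proof. by move=> a b; rewrite -paddE -poppE. Qed.
Fact proot_multiplicative : monoid_morphism (proot 0).
Proof. by split=> // a b; rewrite -pmulE. Qed.
HB.instance Definition _ :=
  GRing.isZmodMorphism.Build K perfection (proot 0) proot_additive.
HB.instance Definition _ :=
  GRing.isMonoidMorphism.Build K perfection (proot 0) proot_multiplicative.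

Lemma proot_exp n a m : proot n a ^+ m = proot n (a ^+ m).
Proof.
elim: m => [|m IHm]; first by rewrite !expr0 -proot1.
by rewrite !exprS IHm -pmulE.
Qed.

Lemma perfection_root m x : exists y, frob m y = x.
Proof.
have [n [a ->]] := prootP x; exists (proot (n + m) a); rewrite proot_exp.
by rewrite -proot_raise.
Qed.

Lemma pchar_perfection : p \in [pchar perfection].
Proof. exact: (rmorph_pchar (proot 0)). Qed.

End PerfectClosure.

(** Over an infinite field an additive exponent is 1 or a power of the characteristic, so this
    amounts to perfectness. *)
Definition additive_powers_onto (L : fieldType) := forall k, (0 < k)%N ->
  (forall a b : L, (a + b) ^+ k = a ^+ k + b ^+ k) ->
  forall c : L, exists s, s ^+ k = c.

(** Differentiate the polynomial identity (X + 1) ^ k = X ^ k + 1 and evaluate at 0. *)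
Lemma additive_exp_eq1 (L : fieldType) k : many_elements L -> k%:R != 0 :> L ->
  (forall a b : L, (a + b) ^+ k = a ^+ k + b ^+ k) -> k = 1%N.
Proof.
move=> Linf k0 kD.
have E : ('X + 1%:P) ^+ k = 'X^k + 1 :> {poly L}.
  by apply: poly_ext => // t; rewrite !hornerE kD expr1n.
have := congr1 (fun q => (q^`()).[0]) E.
rewrite deriv_exp !derivD derivX !derivC !addr0 mul1r derivXn !hornerMn.
rewrite !hornerE expr1n expr0n => /eqP; case: k k0 {kD E} => [|[|k]] //=.
  by rewrite eqxx.
by rewrite mul0rn => /negPf ->.
Qed.

(** In characteristic 0 only k = 1 is additive and K itself serves. In characteristic p write k = q
    p ^ m with q prime to p; injectivity of Frobenius makes q additive, so q = 1. *)
Lemma perfect_extension (K : fieldType) : many_elements K ->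
  exists (L : fieldType) (iota : {rmorphism K -> L}),
    many_elements L /\ additive_powers_onto L.
Proof.
move=> Kinf.
have [[p pcharK]|pchar0] := pselect (exists p, p \in [pchar K]); last first.
  exists K, idfun; split => // k k_gt0 kD c; exists c.
  rewrite (additive_exp_eq1 Kinf _ kD) ?expr1 //.
  have /pcharf0P -> : [pchar K] =i pred0; last by rewrite -lt0n.
  by move=> p; apply/negP => pK; apply: pchar0; exists p.
pose L := perfection pcharK; exists L, (proot pcharK 0).
have Linf : many_elements L.
  move=> n; have [s us ss] := Kinf n.
  exists (map (proot pcharK 0) s); last by rewrite size_map.
  by rewrite map_inj_uniq //; exact: proot_inj.
have pcharL : p \in [pchar L] by exact: pchar_perfection.
split=> // k k_gt0 kD c.
have [m [q [pq kE]]] : exists m q, ~~ (p %| q)%N /\ k = (q * p ^ m)%N.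
  have [q pq kE] := pfactor_coprime (pcharf_prime pcharL) k_gt0.
  exists (logn p k), q; split => //.
  by rewrite -prime_coprime // (pcharf_prime pcharL).
have q1 : q = 1%N.
  apply: (@additive_exp_eq1 L _ Linf) => [|a b].
    by rewrite -(dvdn_pcharf pcharL).
  apply: (frob_inj pcharL (m := m)); rewrite /= frobD //.
  by rewrite -!exprM -kE.
by have [s sE] := perfection_root m c; exists s; rewrite kE q1 mul1n.
Qed.

(** * Tensor powers *)

Section TensorFunctor.
Variables (k : nat) (d : 'I_k -> nat).

(** Indexes the standard basis of the direct sum of the [d i]-th tensor powers of K^n. *)
Definition word n : finType := {i : 'I_k & {ffun 'I_(d i) -> 'I_n}}.

Definition wordT n i (w : {ffun 'I_(d i) -> 'I_n}) : word n :=
  Tagged (fun i => {ffun 'I_(d i) -> 'I_n}) w.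

(** Optional letters at natural positions allow words of different summands to be compared without
    transport. *)
Definition letter n (u : word n) (j : nat) : option 'I_n :=
  omap (tagged u) (insub j).

Lemma letterT n i (w : {ffun 'I_(d i) -> 'I_n}) (j : 'I_(d i)) :
  letter (wordT w) j = Some (w j).
Proof. by rewrite /letter valK. Qed.

Section Field.
Variable K : fieldType.

Definition letter_entry n m (A : 'M[K]_(n, m)) (a : option 'I_n)
    (b : option 'I_m) :=
  if (a, b) is (Some i, Some j) then A i j else 0.

Definition word_entry n m (A : 'M[K]_(n, m)) (u : word n) (v : word m) : K :=
  (tag u == tag v)%:R *
  \prod_(j < d (tag u)) letter_entry A (letter u j) (letter v j).

Lemma word_entryT n m (A : 'M[K]_(n, m)) i w w' :
  word_entry A (@wordT n i w) (@wordT m i w') = \prod_j A (w j) (w' j).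
Proof.
rewrite /word_entry /= eqxx mul1r; apply: eq_bigr => j _.
by rewrite !letterT.
Qed.

Lemma word_entry_tag n m (A : 'M[K]_(n, m)) u v :
  tag u != tag v -> word_entry A u v = 0.
Proof. by rewrite /word_entry => /negPf ->; rewrite mul0r. Qed.

Definition tensor_act n m (A : 'M[K]_(n, m)) :
    'M[K]_(#|{: word n}|, #|{: word m}|) :=
  \matrix_(a, b) word_entry A (enum_val a) (enum_val b).

Lemma sum_word (V : nmodType) n (G : word n -> V) :
  \sum_(a < #|{: word n}|) G (enum_val a) =
  \sum_i \sum_(w : {ffun 'I_(d i) -> 'I_n}) G (wordT w).
Proof.
rewrite -(big_enum_val (A := {: word n})).
have -> : \sum_(i < k) \sum_(w : {ffun 'I_(d i) -> 'I_n}) G (wordT w) =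
    \sum_(u : word n) G (wordT (tagged u)) by rewrite sig_big_dep.
by apply: eq_big => [u|[i w] _]; rewrite ?inE.
Qed.

Lemma word_entry1 n (u v : word n) : word_entry 1%:M u v = (u == v)%:R.
Proof.
have [uv|ne_uv] := eqVneq (tag u) (tag v); last first.
  by rewrite word_entry_tag //; case: (u =P v) ne_uv => [->|]; rewrite ?eqxx.
case: u v uv => [i w] [i' w'] /= ii'; subst i'.
rewrite eq_Tagged /= -/(wordT w) -/(wordT w') word_entryT.
have [->|/eqP ne_ww'] := eqVneq w w'.
  by rewrite big1 // => j _; rewrite mxE eqxx.
have [j wj] : exists j, w j != w' j.
  apply/existsP; apply: contraT => /existsPn ww'; case: ne_ww'.
  by apply/ffunP => j; apply/eqP; have := ww' j; rewrite negbK.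
by rewrite (bigD1 j) //= mxE (negPf wj) mul0r.
Qed.

Lemma word_entryM n m p (A : 'M[K]_(n, m)) (B : 'M[K]_(m, p)) u v :
  \sum_(a < #|{: word m}|)
    word_entry A u (enum_val a) * word_entry B (enum_val a) v =
  word_entry (A *m B) u v.
Proof.
rewrite (sum_word (fun x => word_entry A u x * word_entry B x v)).
case: u v => [i w] [i' w']; rewrite -/(wordT w) -/(wordT w').
rewrite (bigD1 i) //= [X in _ + X]big1 ?addr0 => [|i0 ne_i0]; last first.
  by rewrite big1 // => w0 _; rewrite word_entry_tag ?mul0r // eq_sym.
have [ii'|ne_ii'] := eqVneq i i'; last first.
  rewrite [RHS]word_entry_tag // big1 // => w0 _.
  by rewrite [X in _ * X]word_entry_tag ?mulr0.
subst i'; rewrite word_entryT.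
under [RHS]eq_bigr do rewrite mxE.
rewrite bigA_distr_bigA; apply: eq_bigr => w0 _.
by rewrite !word_entryT -big_split.
Qed.

Lemma tensor_act1 n : tensor_act (1%:M : 'M_n) = 1%:M.
Proof.
apply/matrixP => a b; rewrite !mxE word_entry1.
by rewrite (inj_eq enum_val_inj).
Qed.

Lemma tensor_actM n m p (A : 'M[K]_(n, m)) (B : 'M[K]_(m, p)) :
  tensor_act (A *m B) = tensor_act A *m tensor_act B.
Proof.
apply/matrixP => a b; rewrite !mxE -word_entryM; apply: eq_bigr => c _.
by rewrite !mxE.
Qed.

Definition tensor_functor : pfunctor K := PFunctor tensor_act1 tensor_actM.

Lemma pf_letter_entry n m (a : option 'I_n) (b : option 'I_m) :
  pf 1 (fun A : 'M[K]_(n, m) => letter_entry A a b).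
Proof.
case: a b => [i|] [j|]; try exact: pf_cst_le.
pose l (A : 'M[K]_(n, m)) : K^o := A i j.
have linl : linear l by move=> c A B; rewrite /l !mxE.
exact: (pf_lin (HB.pack l (GRing.isLinear.Build K _ _ _ l linl)
  : {linear 'M[K]_(n, m) -> K^o})).
Qed.

Lemma tensor_degree : degree_le (\max_i d i) tensor_functor.
Proof.
move=> n m a b; pose u := enum_val a; pose v := enum_val b.
have pw : pf (d (tag u)) (fun A : 'M[K]_(n, m) => word_entry A u v).
  apply: pf_scale.
  suff H h :
      pf h (fun A => \prod_(j < h) letter_entry A (letter u j) (letter v j)).
    exact: H.
  elim: h => [|h IHh].
    by apply: eq_pf (pf_cst _ 1) _ => A; rewrite big_ord0.
  have := pf_mul IHh (pf_letter_entry (letter u h) (letter v h)); rewrite addn1.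
  move=> pfS; apply: eq_pf pfS _ => A.
  by rewrite big_ord_recr.
apply: pf_le (leq_bigmax (tag u)) _; apply: eq_pf pw _ => A.
by rewrite mxE.
Qed.

End Field.

Lemma map_tensor_act (K L : fieldType) (iota : {rmorphism K -> L}) n m
    (A : 'M[K]_(n, m)) :
  tensor_act (map_mx iota A) = map_mx iota (tensor_act A).
Proof.
apply/matrixP => a b; rewrite !mxE rmorphM rmorph_nat rmorph_prod.
congr (_ * _); apply: eq_bigr => j _; rewrite /letter_entry.
case: (letter _ _) => [i|]; last by rewrite rmorph0.
by case: (letter _ _) => [h|]; rewrite ?rmorph0 // mxE.
Qed.

End TensorFunctor.

(** * Vanishing on the points of an infinite subfield *)

Section DenseSubfield.
Variables (K L : fieldType) (iota : {rmorphism K -> L}).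
Hypothesis Kinf : many_elements K.

(** The coordinates in r already range over L. One more is freed at a time, f being in it a
    polynomial with infinitely many roots in the image of [iota]. *)
Lemma polyf_dense (W : lmodType L) (f : W -> L) (I : finType) (e : I -> W) :
    polyf f -> (forall a : I -> K, f (\sum_i iota (a i) *: e i) = 0) ->
  forall y : I -> L, f (\sum_i y i *: e i) = 0.
Proof.
move=> [n pff] f0 y.
suff H (r : seq I) a :
    f (\sum_i (if i \in r then y i else iota (a i)) *: e i) = 0.
  have := H (enum I) (fun=> 0).
  by rewrite (eq_bigr (fun i => y i *: e i)) // => i _; rewrite mem_enum.
elim: r a => [|i0 r IHr] a; first exact: f0.
have [i0r|i0r] := boolP (i0 \in r).
  rewrite -[RHS](IHr a); congr f; apply: eq_bigr => i _.
  by rewrite inE; case: eqP => // ->; rewrite i0r.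
have [F [F1 _ _ _]] := hasse_expansion pff.
pose c i := if i \in r then y i else iota (a i).
have E t : (F (\sum_(i | i != i0) c i *: e i) (e i0)).[t] =
    f (\sum_i (if i == i0 then t else c i) *: e i).
  rewrite F1 [in RHS](bigD1 i0) //= eqxx addrC; congr (f (_ + _)).
  by apply: eq_bigr => i /negPf ->.
have F0 : F (\sum_(i | i != i0) c i *: e i) (e i0) = 0.
  apply: (@poly_ext_in _ (range iota)) => [m|_ [b _ <-]].
    have [s us ss] := Kinf m; exists (map iota s).
    rewrite size_map map_inj_uniq //; last exact: fmorph_inj.
    by split => // t /mapP[b _ ->]; exists b.
  rewrite E horner0 -[RHS](IHr (fun i => if i == i0 then b else a i)).
  congr f; apply: eq_bigr => i _; rewrite /c; case: eqP => // ->.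
  by rewrite (negPf i0r).
have := E (y i0); rewrite F0 horner0 => ->; congr f; apply: eq_bigr => i _.
by rewrite inE /c; case: eqP => // ->.
Qed.

Lemma polyf_dense_mx n m (f : 'M[L]_(n, m) -> L) :
    polyf f -> (forall A : 'M[K]_(n, m), f (map_mx iota A) = 0) ->
  forall A, f A = 0.
Proof.
move=> pf f0 A; rewrite [A]matrix_sum_delta pair_big /=.
apply: (polyf_dense (e := fun ij => delta_mx ij.1 ij.2) pf) => a.
rewrite -[RHS](f0 (\matrix_(i, j) a (i, j))); congr f.
rewrite [RHS]matrix_sum_delta pair_big /=; apply: eq_bigr => -[i j] _.
by rewrite !mxE.
Qed.

End DenseSubfield.

Lemma polyf_comp_polyf (K : fieldType) (W : lmodType K) N (f : 'rV[K]_N -> K)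
    (G : W -> 'rV[K]_N) :
  polyf f -> (forall i, polyf (fun w => G w 0 i)) -> polyf (fun w => f (G w)).
Proof.
move=> [n pff] pG; elim: pff => {n f} [c|l|n f g _ + _|m n f g _ + _|//].
- exact: polyf_cst.
- have pS : polyf (fun w => \sum_i G w 0 i * (l (delta_mx 0 i) : K)).
    by apply: polyf_sum => i _; apply: polyf_mul; [exact: pG|exact: polyf_cst].
  apply: eq_polyf pS _ => w; rewrite [in RHS](row_sum_delta (G w)) linear_sum.
  by apply: eq_bigr => i _; rewrite linearZ.
- exact: polyf_add.
- exact: polyf_mul.
Qed.

(** * Symmetric powers *)

Module SymmetricTensors.
Import mpoly SymmetricPower.

Section Generators.
Variable K : fieldType.
Implicit Types V W : vectType K.

Definition basis_vec V (i : 'I_(\dim {:V})) : V := tnth (vbasis {:V}) i.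

Definition basis_prod e V (w : 'I_e -> 'I_(\dim {:V})) : sympow e V :=
  symprod (fun j => basis_vec (w j)).

Lemma sympow_span e V (p : sympow e V) :
  exists c : {ffun 'I_e -> 'I_(\dim {:V})} -> K,
    p = \sum_w c w *: basis_prod w.
Proof.
have /dhomogP hp := dhomog_is_dhomog p.
suff [c cE] : exists c : {ffun 'I_e -> 'I_(\dim {:V})} -> K,
    val p = \sum_w c w *: val (basis_prod w).
  by exists c; apply: val_inj; rewrite cE raddf_sum.
rewrite [val p]mpolyE.
have : forall m, m \in msupp (val p) -> mdeg m = e by [].
elim: (msupp _) => [|m r IHr] rE.
  exists (fun=> 0); rewrite big_nil big1 // => w _; exact: scale0r.
have [m' m'r|c cE] := IHr; first by apply: rE; rewrite inE m'r orbT.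
have [h hE] := idx_mnm_surj (rE m (mem_head _ _)).
exists (fun w => (if w == h then (val p)@_m else 0) + c w).
rewrite big_cons cE; under [RHS]eq_bigr do rewrite scalerDl.
rewrite big_split /=; congr (_ + _); rewrite (bigD1 h) // eqxx.
rewrite [X in _ = _ + X]big1 ?addr0.
  by congr (_ *: _); rewrite -hE; apply/esym; exact: symprod_idx.
by move=> w /negPf ->; rewrite scale0r.
Qed.

Lemma symmap_basis_prod e V W (phi : {linear V -> W})
    (w : 'I_e -> 'I_(\dim {:V})) :
  symmap phi (basis_prod w) =
  \sum_(w' : {ffun 'I_e -> 'I_(\dim {:W})})
    (\prod_j coord (vbasis {:W}) (w' j) (phi (basis_vec (w j))))
      *: basis_prod w'.
Proof.
rewrite symmap_symprod; apply: val_inj; rewrite [RHS]raddf_sum /=.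
transitivity (\prod_(j < e) \sum_l
    coord (vbasis {:W}) l (phi (basis_vec (w j))) *: sym1 (basis_vec l)).
  apply: eq_bigr => j _; rewrite {1}[phi _](coord_vbasis (memvf _)) linear_sum.
  apply: eq_bigr => l _; rewrite linearZ; congr (_ *: sym1 _).
  by rewrite /basis_vec (tnth_nth 0).
rewrite bigA_distr_bigA; apply: eq_bigr => w' _.
by rewrite scaler_prod.
Qed.

Variables (k : nat) (d : 'I_k -> nat).

(** The canonical surjection from tensor powers to symmetric powers, in the coordinates of a basis
    of V. *)
Definition symtensor V (x : 'rV[K]_#|{: word d (\dim {:V})}|) : symsum d V :=
  [ffun i => \sum_(w : {ffun 'I_(d i) -> 'I_(\dim {:V})})
    x 0 (enum_rank (wordT w)) *: basis_prod w : sympow (d i) V].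

Lemma symtensor_linear V : linear (@symtensor V).
Proof.
move=> a x y; apply/ffunP => i; rewrite !ffunE scaler_sumr -big_split /=.
by apply: eq_bigr => w _; rewrite !mxE scalerDl scalerA.
Qed.

HB.instance Definition _ V := GRing.isLinear.Build K
  'rV[K]_#|{: word d (\dim {:V})}| (symsum d V) _ (@symtensor V)
  (@symtensor_linear V).

Lemma symtensor_surj V (p : symsum d V) : exists x, symtensor x = p.
Proof.
have /dep_choice[c cE] i := sympow_span (p i).
exists (\row_a c (tag (enum_val a)) (tagged (enum_val a))).
apply/ffunP => i; rewrite ffunE cE; apply: eq_bigr => w _.
by rewrite mxE enum_rankK.
Qed.

Lemma symtensor_act V W (phi : {linear V -> W}) x :
  symsum_map phi (symtensor x) = symtensor (x *m tensor_act d
    (\matrix_(i, j) coord (vbasis {:W}) j (phi (basis_vec i)))).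
Proof.
set A := \matrix_(i, j) _.
apply/ffunP => i; rewrite !ffunE linear_sum.
under eq_bigr do rewrite linearZ /= symmap_basis_prod scaler_sumr.
rewrite exchange_big; apply: eq_bigr => w' _ /=.
under eq_bigr do rewrite scalerA.
rewrite -scaler_suml; congr (_ *: _); rewrite mxE.
transitivity (\sum_(a < #|{: word d (\dim {:V})}|)
   x 0 (enum_rank (enum_val a)) * word_entry A (enum_val a) (wordT w'));
  last first.
  by apply: eq_bigr => a _; rewrite enum_valK mxE enum_rankK.
rewrite (sum_word (fun u => x 0 (enum_rank u) * word_entry A u (wordT w'))).
rewrite (bigD1 i) //= [X in _ = _ + X]big1 ?addr0.
  apply: eq_bigr => w _; rewrite word_entryT; congr (_ * _).
  by apply: eq_bigr => j _; rewrite mxE.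
move=> i' ne_i'; rewrite big1 // => w _.
by rewrite word_entry_tag ?mulr0.
Qed.

End Generators.
End SymmetricTensors.
Import SymmetricPower SymmetricTensors.

(** * Transfer from tensor powers over L to symmetric powers over K *)

Section NoBadSequence.
Variables (K : fieldType) (k : nat) (d : 'I_k -> nat).
Hypothesis Kinf : many_elements K.

Definition linear_of_mx (V W : vectType K)
    (A : 'M[K]_(\dim {:V}, \dim {:W})) (v : V) : W :=
  \sum_i coord (vbasis {:V}) i v *: \sum_j A i j *: basis_vec j.

Lemma linear_of_mx_linear (V W : vectType K)
    (A : 'M[K]_(\dim {:V}, \dim {:W})) :
  linear (linear_of_mx A).
Proof.
move=> a u v; rewrite /linear_of_mx scaler_sumr -big_split /=.
by apply: eq_bigr => i _; rewrite linearP scalerDl scalerA.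
Qed.

HB.instance Definition _ (V W : vectType K) A := GRing.isLinear.Build K V W _
  (@linear_of_mx V W A) (@linear_of_mx_linear V W A).

Lemma coord_basis_vec (V : vectType K) i j :
  coord (vbasis {:V}) j (basis_vec i) = (i == j)%:R.
Proof.
by rewrite /basis_vec (tnth_nth 0) coord_free ?(basis_free (vbasisP _)).
Qed.

Lemma linear_of_mxK (V W : vectType K) (A : 'M_(\dim {:V}, \dim {:W})) :
  \matrix_(i, j) coord (vbasis {:W}) j (linear_of_mx A (basis_vec i)) = A.
Proof.
apply/matrixP => i j; rewrite mxE /linear_of_mx (bigD1 i) //= coord_basis_vec.
rewrite eqxx scale1r [X in _ + X]big1 ?addr0 => [|i' ne_i']; last first.
  by rewrite coord_basis_vec eq_sym (negPf ne_i') scale0r.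
rewrite linear_sum (bigD1 j) //= linearZ /= coord_basis_vec eqxx mulr1.
rewrite big1 ?addr0 // => j' ne_j'.
by rewrite linearZ /= coord_basis_vec (negPf ne_j') mulr0.
Qed.

(** Pull F back along [symtensor] and map its coefficients to L. *)
Lemma extend_polynomial (L : fieldType) (iota : {rmorphism K -> L}) V
    (F : symsum d V -> K) : polynomial_function F ->
  exists f : 'rV[L]_#|{: word d (\dim {:V})}| -> L,
    polyf f /\ forall x, f (map_mx iota x) = iota (F (symtensor x)).
Proof.
elim=> {F} [c|l|F G _ [f [pf fE]] _ [g [pg gE]]
  |F G _ [f [pf fE]] _ [g [pg gE]]].
- exists (fun=> iota c); split => //; exact: polyf_cst.
- pose c a := iota (l (symtensor (delta_mx 0 a))).
  exists (fun x => \sum_a x 0 a * c a); split.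
    apply: polyf_sum => a _; apply: polyf_mul; last exact: polyf_cst.
    pose p (x : 'rV[L]_#|{: word d (\dim {:V})}|) : L^o := x 0 a.
    have linp : linear p by move=> b x y; rewrite /p !mxE.
    exact: (polyf_lin (HB.pack p (GRing.isLinear.Build L _ _ _ p linp)
      : {linear 'rV[L]_#|{: word d (\dim {:V})}| -> L^o})).
  move=> x; rewrite [in RHS](row_sum_delta x) !linear_sum rmorph_sum.
  by apply: eq_bigr => a _; rewrite !linearZ /= rmorphM mxE.
- exists (fun x => f x + g x); split; first exact: polyf_add.
  by move=> x; rewrite fE gE rmorphD.
- exists (fun x => f x * g x); split; first exact: polyf_mul.
  by move=> x; rewrite fE gE rmorphM.
Qed.

Lemma polyf_tensor_orbit (L : fieldType) n m (f : 'rV[L]_#|{: word d m}| -> L)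
    (x : 'rV[L]_#|{: word d n}|) :
  polyf f -> polyf (fun A : 'M[L]_(n, m) => f (x *m tensor_act d A)).
Proof.
move=> pf; apply: polyf_comp_polyf pf _ => a.
have degA b : polyf (fun A : 'M[L]_(n, m) => tensor_act d A b a).
  by exists (\max_i d i); exact: tensor_degree.
have pS : polyf (fun A : 'M[L]_(n, m) => \sum_b x 0 b * tensor_act d A b a).
  by apply: polyf_sum => b _; apply: polyf_mul; [exact: polyf_cst|].
by apply: eq_polyf pS _ => A; rewrite mxE.
Qed.

(** Lifting the points along [symtensor] gives a bad sequence of tensors over L: the vanishing,
    known for matrices over K, extends to matrices over L by density. *)
Theorem no_bad_symsum (V : nat -> vectType K)
    (F : forall i, symsum d (V i) -> K) (p : forall i, symsum d (V i)) :
    (forall i, polynomial_function (F i)) -> (forall i, F i (p i) != 0) ->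
  ~ (forall i j, (i < j)%N -> forall phi : {linear V j -> V i},
       F i (symsum_map phi (p j)) = 0).
Proof.
move=> pF F1 F0; have [L [iota [Linf Lperf]]] := perfect_extension Kinf.
have [f fP] := dep_choice (fun i => extend_polynomial iota (pF i)).
have [x xE] := dep_choice (fun i => symtensor_surj (p i)).
pose S i := @Witness L (tensor_functor d L) (\dim {:V i}) (f i)
  (map_mx iota (x i)).
have NB := finite_degree_noetherian Linf Lperf (@tensor_degree _ d L).
apply: (NB S).
split=> [i|i|i j ltij] /=.
- by have [] := fP i.
- by have [_ ->] := fP i; rewrite fmorph_eq0 xE.
have [pf fE] := fP i.
apply: (polyf_dense_mx (iota := iota) Kinf) => [|A].
  exact: polyf_tensor_orbit.
rewrite map_tensor_act -map_mxM fE -[A]linear_of_mxK -symtensor_act xE.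
by rewrite F0 ?rmorph0.
Qed.

End NoBadSequence.

(** * Chains of closed subsets *)

Section Corollary.
Variables (K : fieldType) (k : nat) (d : 'I_k -> nat).
Hypothesis Kinf : many_elements K.

Lemma zariski_separation (W : lmodType K) (A : set (zariski W))
    (x : zariski W) :
    closed A -> ~ A x ->
  exists F : W -> K,
    [/\ polynomial_function F, F x != 0 & forall y, A y -> F y = 0].
Proof.
move=> /closed_zariskiE[G Gp ->] /existsNP[F /not_implyP[GF /eqP Fx]].
by exists F; split=> //; [exact: Gp|move=> y; apply].
Qed.

Lemma chain_subset (T : Type) (X : nat -> set T) :
  (forall n, X n.+1 `<=` X n) -> forall m n, (m <= n)%N -> X n `<=` X m.
Proof.
move=> Xdec m n; elim: n => [|n IHn]; first by rewrite leqn0 => /eqP ->.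
rewrite leq_eqVlt => /predU1P[-> //|/IHn Xm x /Xdec]; exact: Xm.
Qed.

(** Stated for families so as to serve both chains of subfunctors and, with [I] the unit type,
    chains of subsets of the limit. *)
Lemma unstable_chain (I : Type) (T : I -> Type)
    (X : nat -> forall V, set (T V)) :
    (forall n V, X n.+1 V `<=` X n V) ->
    ~ (exists N, forall n, (N <= n)%N -> forall V, X n V = X N V) ->
  exists s : nat -> nat, (forall i j, (i <= j)%N -> (s i <= s j)%N) /\
    forall i, exists V p, X (s i) V p /\ ~ X (s i.+1) V p.
Proof.
move=> Xdec nostab.
have /choice[next nextP] N : exists n, (N <= n)%N /\
    exists V p, X N V p /\ ~ X n V p.
  move/forallNP: nostab => /(_ N)/existsNP[n].
  move=> /not_implyP[leNn /existsNP[V neV]].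
  exists n; split => //; apply: contrapT => noVp; apply: neV.
  apply/seteqP; split; first exact: (chain_subset (fun n => Xdec n V)).
  by move=> p Xp; apply: contrapT => nXp; apply: noVp; exists V, p.
exists (fun i => iter i next 0%N); split=> [i j|i]; last first.
  by have [_] := nextP (iter i next 0%N).
elim: j => [|j IHj]; first by rewrite leqn0 => /eqP ->.
rewrite leq_eqVlt => /predU1P[-> //|/IHj/leq_trans]; apply.
by have [] := nextP (iter j next 0%N).
Qed.

(** A point lost between the stages [s i] and [s i.+1] is separated by an equation of the later
    stage. For j > i the j-th point still lies in that stage, as do its images, so the sequence
    would be bad. *)
Lemma symsum_Vec_noetherian : Vec_noetherian K d.
Proof.
move=> X Xclosed Xdec; apply: contrapT => /(unstable_chain Xdec)[s [s_le sP]].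
pose Q i (w : {V : vectType K & ((symsum d V -> K) * symsum d V)%type}) :=
  [/\ polynomial_function (tagged w).1, (tagged w).1 (tagged w).2 != 0,
      X (s i) (tag w) (tagged w).2 &
      forall q, X (s i.+1) (tag w) q -> (tagged w).1 q = 0].
have /choice[w wP] i : exists w, Q i w.
  have [V [p [Xp nXp]]] := sP i.
  have [F [pF Fp F0]] := zariski_separation ((Xclosed (s i.+1)).1 V) nXp.
  by exists (existT _ V (F, p)).
apply: (@no_bad_symsum K k d Kinf (fun i => tag (w i))
  (fun i => (tagged (w i)).1) (fun i => (tagged (w i)).2))
  => [i|i|i j ltij phi].
- by have [] := wP i.
- by have [] := wP i.
have [_ _ _ ->//] := wP i; have [_ _ Xj _] := wP j.
apply: (Xclosed (s i.+1)).2; exists (tagged (w j)).2 => //.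
apply: (chain_subset (fun n => Xdec n (tag (w j)))) Xj.
exact: s_le.
Qed.

(** * Passage to the projective limit *)

Lemma polynomial_function_comp (W W' : lmodType K) (F : W -> K)
    (l : {linear W' -> W}) :
  polynomial_function F -> polynomial_function (fun x => F (l x)).
Proof.
elim=> {F} [c|h|F G _ pF _ pG|F G _ pF _ pG].
- exact: polyfun_cst.
- exact: (polyfun_lin (h \o l)).
- exact: polyfun_add.
- exact: polyfun_mul.
Qed.

Lemma symsum_map_linear (V W : vectType K) (phi : {linear V -> W}) :
  linear (@symsum_map K k d V W phi).
Proof. by move=> a x y; apply/ffunP => i; rewrite !ffunE linearP. Qed.

HB.instance Definition _ (V W : vectType K) (phi : {linear V -> W}) :=
  GRing.isLinear.Build K (symsum d V) (symsum d W) _ (@symsum_map K k d V W phi)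
    (symsum_map_linear phi).

(** The nonvanishing loci around y of functions on a single level generate a filter, since two
    levels m and n can be compared at level m + n. This filter converges to y in the product
    topology, so one such locus avoids Z. *)
Lemma limit_separation (Z : set (symsum_limit K d)) (y : symsum_limit K d) :
    closed Z -> ~ Z y ->
  exists m (F : symsum d 'cV[K]_m -> K),
    [/\ polynomial_function F, F (val y m) != 0 &
        forall z, Z z -> F (val z m) = 0].
Proof.
move=> Zclosed Zy.
pose T := prod_topology (fun n => zariski (symsum d 'cV[K]_n)).
pose basic : set_system T := [set A |
  exists m (F : symsum d 'cV[K]_m -> K), [/\ polynomial_function F,
    F (val y m) != 0 &
    forall z : symsum_limit K d, F (val z m) != 0 -> A (val z)]].
have basic_filter : Filter basic.
  split=> [|A B [m [F [pF Fy FA]]] [n [G [pG Gy GB]]]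
    |A B AB [m [F [pF Fy FA]]]].
  - exists 0%N, (fun=> 1); split => //; first exact: polyfun_cst.
    exact: oner_neq0.
  - have le_m : (m <= m + n)%N by exact: leq_addr.
    have le_n : (n <= m + n)%N by exact: leq_addl.
    exists (m + n)%N, (fun x : symsum d 'cV[K]_(m + n) =>
      F (symsum_map (first_coords le_m) x) *
      G (symsum_map (first_coords le_n) x)); split.
    + by apply: polyfun_mul; exact: polynomial_function_comp.
    + by rewrite !symsum_limit_trunc mulf_neq0.
    move=> z; rewrite !symsum_limit_trunc mulf_eq0 => /norP[Fz Gz].
    by split; [exact: FA|exact: GB].
  - by exists m, F; split=> // z /FA; exact: AB.
have : basic --> (val y : T).
  apply/cvg_sup => n A [_ [[B openB <-] By] BA].
  have [F [pF Fy F0]] := zariski_separation (open_closedC openB)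
    (fun nB : (~` B) (val y n) => nB By).
  exists n, F; split=> // z Fz; apply: BA; apply: contrapT => nBz.
  by move/eqP: Fz; apply; apply: F0.
have [B openB BZ] : open (~` Z) by exact: closed_openC.
have By : B (val y) by have : (set_val @^-1` B) y by rewrite BZ.
move=> /(_ B)[|m [F [pF Fy FB]]]; first exact: open_nbhs_nbhs.
exists m, F; split=> // z Zz; apply: contrapT => /eqP Fz.
have : (set_val @^-1` B) z by exact: FB.
by rewrite BZ.
Qed.

(** Along the affine family psi the value of F is a polynomial in s with infinitely many nonzero
    roots. *)
Lemma vanishing_limit (V W : vectType K) (F : symsum d W -> K) (p : symsum d V)
    (psi : K -> {linear V -> W}) (psi0 psi1 : V -> W) :
    polynomial_function F -> (forall s v, psi s v = psi0 v + s *: psi1 v) ->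
    (forall s, s != 0 -> F (symsum_map (psi s) p) = 0) ->
  F (symsum_map (psi 0) p) = 0.
Proof.
move=> pF psiE F0.
have [f [pf fE]] := extend_polynomial (idfun : {rmorphism K -> K}) pF.
have [x xE] := symtensor_surj p; rewrite -{p}xE in F0 *.
have mapidE n m (A : 'M[K]_(n, m)) : map_mx (idfun : K -> K) A = A.
  by apply/matrixP => i j; rewrite mxE.
pose M (h : V -> W) := \matrix_(i, j) coord (vbasis {:W}) j (h (basis_vec i)).
have ME s : M (psi s) = M psi0 + s *: M psi1.
  by apply/matrixP => i j; rewrite !mxE psiE linearD linearZ.
have fs s : F (symsum_map (psi s) (symtensor x)) =
    f (x *m tensor_act d (M psi0 + s *: M psi1)).
  by rewrite symtensor_act -[RHS]/(f _) -ME -[in RHS](mapidE _ _ (_ *m _)) fE.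
have [n pn] := polyf_tensor_orbit x pf.
have [G [G1 _ _ _]] := hasse_expansion pn.
rewrite fs -G1 (_ : G _ _ = 0) ?horner0 //.
apply: (@poly_ext_in _ [set s | s != 0]) => [m|s /= s0]; last first.
  by rewrite G1 -fs horner0 F0.
(* One element more than m, because 0 may have to be removed. *)
have [r ur szr] := Kinf m.+1.
exists (take m (rem 0 r)); split.
- by rewrite take_uniq // rem_uniq.
- rewrite size_takel //; have [r0|r0] := boolP (0 \in r).
    by rewrite size_rem // szr.
  by rewrite rem_id // szr.
- move=> t /mem_take; rewrite mem_rem_uniq // inE => /andP[]; exact.
Qed.

Lemma first_coordsE m n (le_mn : (m <= n)%N) (v : 'cV[K]_n) :
  first_coords le_mn v = rowsub (widen_ord le_mn) 1%:M *m v.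
Proof. by rewrite mul_rowsub_mx mul1mx. Qed.

Lemma first_coords_usubmx m n p (le_mn : (m <= n)%N) (le_mnp : (m <= n + p)%N)
    (v : 'cV[K]_(n + p)) :
  first_coords le_mnp v = first_coords le_mn (usubmx v).
Proof.
by apply/matrixP => i j; rewrite !mxE; congr (v _ _); apply: val_inj.
Qed.

Lemma GL_act_first N (g : 'M[K]_N) (y : symsum_limit K d) m
    (le_mN : (m <= N)%N) :
  val (GL_act g y) m = symsum_map (first_coords le_mN \o mulmx g) (val y N).
Proof.
have le_mNm : (m <= N + m)%N by exact: leq_addl.
rewrite /= -(GL_act_trunc g y (leqnn m) le_mNm).
rewrite -(symsum_limit_trunc y (leq_addr m N)).
rewrite -[LHS]/((symsum_map _ \o symsum_map _) _) -symsum_map_comp.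
rewrite -[RHS]/((symsum_map _ \o symsum_map _) _) -symsum_map_comp.
apply: eq_symsum_map => v /=.
rewrite (first_coords_usubmx le_mN) (first_coords_usubmx (leqnn N)).
rewrite -[in LHS](vsubmxK v) /diag1 mul_block_col !mul0mx addr0 col_mxKu.
congr (first_coords _ (_ *m _)); apply/matrixP => i j.
by rewrite [RHS]mxE; congr (usubmx v _ _); apply: val_inj.
Qed.

(** After padding, phi is the specialization at s = 0 of truncations of invertible matrices.
    Stability under these gives the vanishing for s != 0, and it passes to s = 0. *)
Lemma GL_stable_vanishing (Z : set (symsum_limit K d)) n m
    (F : symsum d 'cV[K]_m -> K) (y : symsum_limit K d)
    (phi : {linear 'cV[K]_n -> 'cV[K]_m}) :
    GL_stable Z -> polynomial_function F ->
    (forall z, Z z -> F (val z m) = 0) -> Z y ->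
  F (symsum_map phi (val y n)) = 0.
Proof.
move=> Zstable pF F0 Zy; pose a := (m + n)%N.
have le_ma : (m <= a)%N by exact: leq_addr.
have le_na : (n <= a)%N by exact: leq_addl.
have le_maa : (m <= a + a)%N by exact: leq_trans (leq_addl a a).
have le_naa : (n <= a + a)%N by exact: leq_trans (leq_addl a a).
pose Phi : 'M[K]_(m, n) := \matrix_(i, j) phi (delta_mx j 0) i 0.
have PhiE v : phi v = Phi *m v.
  rewrite {1}[v]matrix_sum_delta linear_sum; apply/matrixP => i j.
  rewrite !ord1 summxE mxE; apply: eq_bigr => l _.
  by rewrite big_ord1 linearZ !mxE mulrC.
pose E : 'M[K]_(m, a) := rowsub (widen_ord le_ma) 1%:M.
have EE : E *m E^T = 1%:M.
  rewrite /E mul_rowsub_mx mul1mx; apply/matrixP => i j; rewrite !mxE.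
  by rewrite -!val_eqE /= eq_sym.
(* M is phi from the first n to the first m coordinates, padded with zeros to a square matrix. *)
pose M : 'M[K]_a := E^T *m Phi *m rowsub (widen_ord le_na) 1%:M.
(* For s != 0 this matrix is invertible, and its first m rows specialize at
   s = 0 to phi on the first n coordinates. *)
pose g s : 'M[K]_(a + a) := block_mx M s%:M 1%:M 0.
have g_unit s : s != 0 -> g s \in unitmx.
  move=> s0; pose h := block_mx 0 1%:M (s^-1)%:M (- (s^-1 *: M)).
  suff /mulmx1_unit[] : g s *m h = 1%:M by [].
  rewrite /g /h mulmx_block !mulmx0 !mul0mx !mulmx1 !addr0 add0r.
  rewrite -scalar_mxM mulfV // mul_scalar_mx scalerN scalerA mulfV // scale1r.
  by rewrite subrr -scalar_mx_block.
pose psi s : {linear 'cV[K]_(a + a) -> 'cV[K]_m} :=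
  first_coords le_maa \o mulmx (g s).
have psiE s v : psi s v = first_coords le_ma (M *m usubmx v) +
    s *: first_coords le_ma (dsubmx v).
  rewrite /= (first_coords_usubmx le_ma) -[in LHS](vsubmxK v) /g mul_block_col.
  by rewrite col_mxKu linearD mul_scalar_mx linearZ.
have -> : symsum_map phi (val y n) = symsum_map (psi 0) (val y (a + a)%N).
  rewrite -(symsum_limit_trunc y le_naa).
  rewrite -[LHS]/((symsum_map _ \o symsum_map _) _) -symsum_map_comp.
  apply: eq_symsum_map => v; rewrite psiE scale0r addr0 /= PhiE.
  rewrite (first_coords_usubmx le_na) !first_coordsE -/E /M !mulmxA EE mul1mx.
  by rewrite -mulmxA.
apply: (vanishing_limit pF psiE) => s s0.
rewrite -GL_act_first; apply: F0.
by apply: (Zstable _ (g s) (g_unit s s0)); exists y.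
Qed.

Lemma symsum_GL_noetherian : GL_noetherian K d.
Proof.
move=> Y Yprop Ydec; apply: contrapT => nostab.
have [||s [s_le sP]] :=
  @unstable_chain unit (fun=> symsum_limit K d) (fun n _ => Y n).
- by move=> n _; exact: Ydec.
- by move=> [N NP]; apply: nostab; exists N => n leNn; exact: NP tt.
pose Q i (w : {m : nat & ((symsum d 'cV[K]_m -> K) * symsum_limit K d)%type}) :=
  [/\ polynomial_function (tagged w).1,
      (tagged w).1 (val (tagged w).2 (tag w)) != 0, Y (s i) (tagged w).2 &
      forall z, Y (s i.+1) z -> (tagged w).1 (val z (tag w)) = 0].
have /choice[w wP] i : exists w, Q i w.
  have [_ [y [Yy nYy]]] := sP i.
  have [m [F [pF Fy F0]]] := limit_separation (Yprop (s i.+1)).1 nYy.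
  by exists (existT _ m (F, y)).
apply: (@no_bad_symsum K k d Kinf (fun i => 'cV[K]_(tag (w i)))
  (fun i => (tagged (w i)).1) (fun i => val (tagged (w i)).2 (tag (w i))))
  => [i|i|i j ltij phi].
- by have [] := wP i.
- by have [] := wP i.
have [pF _ _ F0] := wP i; have [_ _ Yj _] := wP j.
apply: (GL_stable_vanishing phi (Yprop (s i.+1)).2 pF F0).
by apply: (chain_subset Ydec) Yj; exact: s_le.
Qed.

End Corollary.

Theorem corollary6 (K : fieldType) (K_infinite : infinite_set [set: K])
    (k : nat) (d : 'I_k -> nat) :
  Vec_noetherian K d /\ GL_noetherian K d.
Proof.
have Kinf := infinite_many_elements K_infinite.
by split; [exact: symsum_Vec_noetherian|exact: symsum_GL_noetherian].
Qed.
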